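(* Let $D=I\cup I'$ generate a traveling horseshoe $D_\infty$ of period $k$. Let $\theta\in\mathbb{T}$ be such that $\sigma(\theta)$ is periodic under $\sigma$, put $\theta'=\theta+\tfrac12$, and suppose that $\theta,\theta'\notin D_\infty\cup M(D)$. Then there exists a non-degenerate invariant lamination $\sim$ with $\theta\sim\theta'$. In particular, for every basic non-rotational critical diameter $\ell_\theta=\overline{\theta\theta'}$ there exists a non-degenerate invariant lamination $\sim$ with $\theta\sim\theta'$.
   Context: $\mathbb{T}=\mathbb{R}/\mathbb{Z}$ is identified with the boundary of the closed unit disk $\mathbb{D}$; $\sigma(x)=2x\bmod1$; for $x\in\mathbb{T}$, $x'=x+\tfrac12$; $[x,y]$, $(x,y)$ are arcs running counterclockwise from $x$ to $y$. Laminations. Two closed sets $A,B\subset\mathbb{T}$ are unlinked if their convex hulls in $\mathbb{D}$ are disjoint. A lamination is a closed equivalence relation on $\mathbb{T}$ (closed graph) with nowhere dense classes such that distinct classes are unlinked. The degenerate lamination identifies all points. A lamination is invariant if $\sigma(C)$ is a class for every class $C$. General horseshoe. Let $I=[\alpha,\beta]$ and $I'=[\alpha',\beta']$ be two disjoint closed arcs not containing $0$ or $\tfrac12$ (where $\alpha'=\alpha+\tfrac12$, $\beta'=\beta+\tfrac12$), with either $\beta,\alpha'$ periodic of period $k$, or $\beta',\alpha$ periodic of period $k$. Then $\sigma^k$ maps each of the four endpoints of $I$, $I'$ to one of these endpoints. For each endpoint $e$ of $I$ or $I'$, let $J\in\{I,I'\}$ be the arc having $\sigma^k(e)$ as an endpoint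 and let $e^*$ be the other endpoint of $J$; let $H_e$ be the closed subarc from $e$ to the $\sigma^k$-preimage of $e^*$ closest to $e$ within the one of $I,I'$ that contains $e$. (For example, if $\beta,\alpha'$ are periodic, then the piece at $\beta$ runs from $\beta$ to the closest $\sigma^k$-preimage of $\alpha$ in $I$, and the piece at $\alpha$ runs from $\alpha$ to the closest $\sigma^k$-preimage of $\beta'$ in $I$.) Let $H$ be the union of the four arcs $H_e$. The general horseshoe of period $k$ generated by $D=I\cup I'$ is $D_\infty=\{x:\sigma^{ki}(x)\in H\text{ for all }i\ge0\}$. The main holes are the two components $(\beta',\alpha)$ and $(\beta,\alpha')$ of $\mathbb{T}\setminus D$, and $M(D)$ is their union. $D_\infty$ is a traveling horseshoe if the convex hulls of $\sigma(H),\dots,\sigma^{k-1}(H)$ are disjoint from the convex hull of $H$, except possibly for their boundaries. Rotational orbit. A periodic orbit $E$ of $\sigma$ is rotational if $\sigma|_E$ is conjugate, by an orientation preserving homeomorphism of $\mathbb{T}$, to the restriction of a rigid rotation of $\mathbb{T}$ to the orbit of $0$. It is known (Bullett–Sentenac) that if $\theta\in[0,\tfrac12)$ and $\theta$ is preperiodic then $[\theta,\theta']$ contains a unique rotational periodic orbit $A_\theta$. Canonic horseshoe and basic non-rotational diameters. Let $\theta\in(0,\tfrac12)$ with $\sigma(\theta)$ periodic; then $A=A_\theta$ has period $k\ge2$ and $\mathbb{T}\setminus A$ has a unique component of length greater than $\tfrac12$; write it as $(\alpha',\beta)$ (counterclockwise, it contains $0$), and put $\alpha=\alpha'+\tfrac12$,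 $\beta'=\beta+\tfrac12$, $I=[\alpha,\beta]$, $I'=[\alpha',\beta']$, $D=I\cup I'$ (equivalently, $D$ is the $\sigma$-preimage of the closure of the shortest component of $\mathbb{T}\setminus A$). Here $\beta,\alpha'\in A$ are fixed by $\sigma^k$, and $D$ generates the canonic traveling horseshoe $D_\infty(A_\theta)=\{x:\sigma^{ki}(x)\in D\ \forall i\ge0\}$ of period $k$. The critical diameter $\ell_\theta$ (with $\sigma(\theta)$ periodic) is basic non-rotational if $\{\theta,\theta'\}\cap D_\infty(A_\theta)=\emptyset$. *)

(* Defs.v *)
From HB Require Import structures.
From Stdlib Require Export RelationClasses.
From mathcomp Require Export all_boot all_order all_algebra.
From mathcomp Require Export generic_quotient ring_quotient.
From mathcomp Require Export all_classical all_reals all_analysis.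

Set Implicit Arguments.
Unset Strict Implicit.
Unset Printing Implicit Defensive.

Import Order.TTheory GRing.Theory Num.Theory numFieldNormedType.Exports.

Local Open Scope classical_set_scope.
Local Open Scope ring_scope.

Definition quotRZ (R : realType) : Type :=
  Quotient.quot (GRing.ZmodClosed.clone R (@Num.int_num_subdef R) _).

HB.instance Definition _ (R : realType) := GRing.Zmodule.on (quotRZ R).
HB.instance Definition _ (R : realType) := Quotient.on (quotRZ R).

Definition circle (R : realType) : Type := quotient_topology (quotRZ R).

HB.instance Definition _ (R : realType) :=
  Topological.copy (circle R) (quotient_topology (quotRZ R)).
HB.instance Definition _ (R : realType) :=
  GRing.Zmodule.copy (circle R) (quotRZ R).

Section Circle.
Variable R : realType.
Local Notation T := (circle R).
Implicit Types (x y z e p q t : T) (A B : set T) (k : nat).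

Definition circle_of (r : R) : T := (\pi_(quotRZ R) r)%qT.

(** The representative of [x] in [0, 1). *)
Definition coord x : R :=
  let r : R := repr (x : quotRZ R) in r - (Num.floor r)%:~R.

Definition half : T := circle_of 2^-1.

Definition sigma x : T := x *+ 2.

Definition antipode x : T := x + half.

(** Length of the arc running counterclockwise from [x] to [y]; it is [0] when
    [x = y], so that then [carc x y] is a point and [oarc x y] is empty. *)
Definition arc_length x y : R := coord (y - x).

Definition carc x y : set T := [set z | arc_length x z <= arc_length x y].

Definition oarc x y : set T := [set z | 0 < arc_length x z < arc_length x y].

Definition circle_dist x y : R := Num.min (arc_length x y) (arc_length y x).

Definition embed x : R^o * R^o :=
  (cos (2 * pi * coord x), sin (2 * pi * coord x)).

Definition hull A : set (R^o * R^o) :=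
  smallest (@convex_set R (R^o * R^o)%type) (embed @` A).

Definition boundary (C : set (R^o * R^o)) : set (R^o * R^o) :=
  closure C `\` interior C.

Definition unlinked A B := hull A `&` hull B = set0.

Definition nowhere_dense A := interior (closure A) = set0.

Definition eqv_class (E : T -> T -> Prop) x : set T := [set y | E x y].

Definition lamination (E : T -> T -> Prop) :=
  [/\ Equivalence E,
      closed [set u : T * T | E u.1 u.2],
      forall x, nowhere_dense (eqv_class E x) &
      forall x y, eqv_class E x <> eqv_class E y ->
        unlinked (eqv_class E x) (eqv_class E y)].

Definition degenerate (E : T -> T -> Prop) := forall x y, E x y.

Definition invariant_lamination (E : T -> T -> Prop) :=
  lamination E /\
  forall x, exists y, sigma @` eqv_class E x = eqv_class E y.

Definition is_periodic x := exists2 n, (0 < n)%N & iter n sigma x = x.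

(** Least period. *)
Definition has_period k x :=
  [/\ (0 < k)%N, iter k sigma x = x &
      forall j, (0 < j < k)%N -> iter j sigma x <> x].

(** Horseshoes. The endpoints [a], [b] determine the arcs [I = [a, b]] and
    [I' = [a', b']], where the prime is the antipode. *)

Definition hs_domain (a b : T) : set T :=
  carc a b `|` carc (antipode a) (antipode b).

Definition main_holes (a b : T) : set T :=
  oarc (antipode b) a `|` oarc b (antipode a).

Definition generates_horseshoe (a b : T) k :=
  [/\ carc a b `&` carc (antipode a) (antipode b) = set0,
      ~ hs_domain a b 0,
      ~ hs_domain a b half &
      (has_period k b /\ has_period k (antipode a)) \/
      (has_period k (antipode b) /\ has_period k a)].

(** The endpoint other than [e] of the one of [I], [I'] having [e] as an
    endpoint. *)
Definition other_end (a b e : T) : T :=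
  if e == a then b else if e == b then a
  else if e == antipode a then antipode b else antipode a.

(** The points [p] of [K] with [sigma^k p = t] that are closest to [e]. Within
    [I] or [I'], which are shorter than 1/2, [circle_dist] is the distance
    along the arc. *)
Definition closest_preimage k t (K : set T) e : set T :=
  [set p | [/\ K p, iter k sigma p = t &
    forall q, K q -> iter k sigma q = t -> circle_dist e p <= circle_dist e q]].

(** The union of the four arcs [H_e], [e = a, b, a', b']. *)
Definition hs_pieces (a b : T) k : set T :=
  let a' := antipode a in
  let b' := antipode b in
  let target e := other_end a b (iter k sigma e) in
  (\bigcup_(p in closest_preimage k (target a) (carc a b) a) carc a p)
  `|` (\bigcup_(p in closest_preimage k (target b) (carc a b) b) carc p b)
  `|` (\bigcup_(p in closest_preimage k (target a') (carc a' b') a') carc a' p)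
  `|` (\bigcup_(p in closest_preimage k (target b') (carc a' b') b') carc p b').

Definition horseshoe (a b : T) k : set T :=
  [set x | forall i, hs_pieces a b k (iter (k * i) sigma x)].

Definition traveling_horseshoe (a b : T) k :=
  generates_horseshoe a b k /\
  forall j, (0 < j < k)%N ->
    let C := hull (hs_pieces a b k) in
    let Cj := hull (iter j sigma @` hs_pieces a b k) in
    C `&` Cj `<=` boundary C `&` boundary Cj.

Definition periodic_orbit A :=
  exists2 x, is_periodic x & A = range (fun i : nat => iter i sigma x).

Definition homeomorphism (h : T -> T) :=
  continuous h /\
  exists g : T -> T, [/\ continuous g, cancel h g & cancel g h].

(** [h] preserves the counterclockwise cyclic order of triples. *)
Definition orientation_preserving (h : T -> T) :=
  forall x y z, oarc x z y -> oarc (h x) (h z) (h y).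

Definition rotational_orbit A :=
  periodic_orbit A /\
  exists (h : T -> T) (rho : T),
    [/\ homeomorphism h, orientation_preserving h,
        h @` A = range (fun n : nat => rho *+ n) &
        {in A, forall x, h (sigma x) = h x + rho}].

Definition is_component (C B : set T) :=
  exists2 x, B x & C = connected_component B x.

(** [A] is the rotational orbit of [theta], of period [k], and [(a', b)] is the
    component of its complement longer than 1/2. *)
Definition canonic_data (theta : T) A k (a b : T) :=
  [/\ rotational_orbit A,
      A `<=` carc theta (antipode theta),
      forall x, A x -> has_period k x,
      is_component (oarc (antipode a) b) (~` A) &
      2^-1 < arc_length (antipode a) b].

Definition canonic_horseshoe (a b : T) k : set T :=
  [set x | forall i, hs_domain a b (iter (k * i) sigma x)].

Definition basic_nonrotational (theta : T) :=
  [/\ oarc 0 half theta,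
      is_periodic (sigma theta) &
      exists A k a b,
        [/\ canonic_data theta A k a b,
            ~ canonic_horseshoe a b k theta &
            ~ canonic_horseshoe a b k (antipode theta)]].

End Circle.

(* Main.v *)
(** Let [b], [a'] be the two endpoints fixed by [sigma^k]; call [{b, a'}] the main
    leaf. Pull it back by the two branches of [sigma^-1] on the open half circles
    cut out by the diameter [l] from [theta] to [theta'], which requires that no
    forward image of the main leaf meets [l] or the interior of [D]. Points are
    equivalent when no iterated preimage of the main leaf separates them strictly.
    No leaf separates [theta] from [theta'], since each lies in an open half circle.

    The relation is transitive, and its classes are unlinked, once every leaf is
    approximated by leaves from one side. By pulling back, this reduces to
    finding leaves that converge to the main leaf from the side of [D]. If a
    single leaf separates [l] from the main leaf then contracting it by the branch
    of [sigma^-k] fixing [b] and [a'] gives such a sequence. This is where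
    [theta] outside of [D_oo] enters: [theta] lies in an arc complementary to
    [D_oo] inside [D], an iterate of which is complementary to [H] inside [D], and
    the endpoints of the arcs met on the way back span leaves, until an arc
    contains [theta] or [theta'], where the leaf becomes the one sought.

    For a traveling horseshoe, no image of the main leaf crosses the hull of [H], so
    its endpoints lie in the closure of one component of the complement of [H];
    comparing lengths of leaves, which follow [t -> min (2 t) (1 - 2 t)], shows
    that this component is a main hole. For a canonic horseshoe the orbit [A] lies
    in a closed main hole. *)

Require Import Defs.
From mathcomp Require Import lra ring zify.

Set Implicit Arguments.
Unset Strict Implicit.
Unset Printing Implicit Defensive.

Import Order.TTheory GRing.Theory Num.Theory numFieldNormedType.Exports.

Local Open Scope classical_set_scope.
Local Open Scope ring_scope.

(** * Coordinates on the circle *)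

Section Circle.
Variable R : realType.
Local Notation T := (circle R).
Local Notation pr := (@circle_of R).
Local Notation sg := (@sigma R).

Lemma circle_ofD (r s : R) : pr (r + s) = pr r + pr s.
Proof. exact: (raddfD (\pi_(quotRZ R))%qT). Qed.

Lemma circle_of0 : pr 0 = 0.
Proof. exact: (raddf0 (\pi_(quotRZ R))%qT). Qed.

Lemma circle_ofMn (r : R) n : pr (r *+ n) = pr r *+ n.
Proof. by elim: n => [|n IH]; rewrite ?circle_of0// !mulrS circle_ofD IH. Qed.

Lemma circle_of_eq (r s : R) : pr r = pr s <-> exists n : int, r = s + n%:~R.
Proof.
have E u v : (u - v \is a Num.int) = (\pi_(quotRZ R) u == \pi_(quotRZ R) v)%qT :=
  Quotient.idealrBE (GRing.ZmodClosed.clone R (@Num.int_num_subdef R) _) u v.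
split => [rs|[n ->]].
  have : r - s \is a Num.int by rewrite E; apply/eqP.
  by move=> /intrP[n En]; exists n; rewrite -En; ring.
have : s + n%:~R - s \is a Num.int by rewrite addrC addKr intr_int.
by rewrite E => /eqP.
Qed.

Lemma coordK (x : T) : pr (coord x) = x.
Proof.
transitivity (pr (repr (x : quotRZ R))); last by rewrite /circle_of reprK.
apply/circle_of_eq; exists (- Num.floor (repr (x : quotRZ R))).
by rewrite /coord mulrNz.
Qed.

Lemma coord_itv (x : T) : 0 <= coord x < 1.
Proof.
rewrite /coord; set r := repr _.
by have /andP[h1 h2] := floor_itv r; rewrite intrD in h2; lra.
Qed.

(** Equalities on the circle lift to the reals up to an integer; this removes the integer when the
    two sides differ by less than 1. *)
Lemma int_small (n : int) (x : R) : -1 < x < 1 -> x = n%:~R -> x = 0.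
Proof.
move=> hx E; rewrite E in hx *.
have : (-1)%:~R < n%:~R :> R by rewrite intrN; lra.
have : n%:~R < 1%:~R :> R by lra.
rewrite !ltr_int => h1 h2.
by have -> : n = 0 by lia.
Qed.

Lemma coordP (r : R) (x : T) : 0 <= r < 1 -> x = pr r -> coord x = r.
Proof.
move=> hr e; have := coordK x; rewrite e => /circle_of_eq[n En].
have := coord_itv (pr r) => h; rewrite En in h *.
by rewrite (@int_small n n%:~R) ?addr0 //; lra.
Qed.

Lemma arc_length_itv (e x : T) : 0 <= arc_length e x < 1.
Proof. exact: coord_itv. Qed.

Lemma arc_lengthK (e x : T) : e + pr (arc_length e x) = x.
Proof. by rewrite /arc_length coordK addrC subrK. Qed.

Lemma arc_lengthP (e x : T) (r : R) : 0 <= r < 1 -> x = e + pr r -> arc_length e x = r.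
Proof. by move=> hr ->; apply: coordP => //; rewrite addrC addKr. Qed.

Lemma arc_length0 (e : T) : arc_length e e = 0.
Proof. by apply: arc_lengthP; rewrite ?circle_of0 ?addr0//; lra. Qed.

Lemma arc_length_inj (e x y : T) : arc_length e x = arc_length e y -> x = y.
Proof. by move=> h; rewrite -(arc_lengthK e x) h arc_lengthK. Qed.

(** Reads arc lengths from one base point [e]; the boolean is the full turn added when the arc
    leaving [x] reaches [e] on its way to [y]. *)
Lemma arc_length_base (e x y : T) :
  arc_length x y = arc_length e y - arc_length e x
                 + (arc_length e y < arc_length e x)%R%:R.
Proof.
have hx := arc_length_itv e x; have hy := arc_length_itv e y.
apply: arc_lengthP; first by case: ltP => /= h; lra.
rewrite -{1}(arc_lengthK e y) -{1}(arc_lengthK e x) -addrA; congr (_ + _).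
rewrite -circle_ofD; apply/circle_of_eq.
by case: ltP => /= h; [exists (-1)|exists 0]; rewrite ?mulrNz ; lra.
Qed.

Lemma circle_of1 : pr 1 = 0.
Proof. by rewrite -circle_of0; apply/circle_of_eq; exists 1; rewrite add0r. Qed.

Lemma sigmaD (x y : T) : sigma (x + y) = sigma x + sigma y.
Proof. by rewrite /sigma mulrnDl. Qed.

Lemma iter_sigma (j : nat) (x : T) : iter j sg x = x *+ (2 ^ j).
Proof. by elim: j => [|j IH] //=; rewrite IH /sigma -mulrnA expnS mulnC. Qed.

Lemma iter_sigmaD (j : nat) (x y : T) :
  iter j sg (x + y) = iter j sg x + iter j sg y.
Proof. by rewrite !iter_sigma mulrnDl. Qed.

Lemma iter_sigma_pr (j : nat) (r : R) : iter j sg (pr r) = pr (2 ^+ j * r).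
Proof. by rewrite iter_sigma -circle_ofMn -natrX mulr_natl. Qed.

Lemma sigma_half : sigma (half R) = 0.
Proof.
rewrite /half/sigma -circle_ofMn -circle_of1; congr pr; lra. Qed.

Lemma antipodeK (x : T) : antipode (antipode x) = x.
Proof. by rewrite /antipode -addrA -circle_ofD (_ : 2^-1 + 2^-1 = 1 :> R) ?circle_of1 ?addr0//; lra. Qed.

Lemma sigma_antipode (x : T) : sigma (antipode x) = sigma x.
Proof. by rewrite sigmaD sigma_half addr0. Qed.

Lemma iter_sigma_antipode j (x : T) : (0 < j)%N -> iter j sg (antipode x) = iter j sg x.
Proof. by case: j => // j _; rewrite !iterSr sigma_antipode. Qed.

Lemma sigma_eq (x y : T) : sigma x = sigma y -> x = y \/ x = antipode y.
Proof.
rewrite -(arc_lengthK y x) sigmaD -[RHS]addr0 => /addrI.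
have := arc_length_itv y x; set r := arc_length y x => hr.
rewrite /sigma -circle_ofMn -circle_of0 => /circle_of_eq[n En].
have : (-1)%:~R < n%:~R :> R by rewrite intrN; lra.
have : n%:~R < 2%:~R :> R by lra.
rewrite !ltr_int => h1 h2.
have [n0|n1] : n = 0 \/ n = 1 by lia.
  by left; rewrite (_ : r = 0) ?circle_of0 ?addr0//; rewrite n0 in En; lra.
right; rewrite (_ : r = 2^-1) //; rewrite n1 in En; lra.
Qed.

End Circle.

(** * Chords and convex hulls *)

Section Geometry.
Variable R : realType.
Local Notation T := (circle R).
Implicit Types u v w z : (R^o * R^o)%type.
Local Notation pr := (@circle_of R).

(* Twice the signed area of the triangle [u v w]. *)
Definition orient u v w : R :=
  (v.1 - u.1) * (w.2 - u.2) - (v.2 - u.2) * (w.1 - u.1).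

Lemma convex_setP (A : set (R^o * R^o)) :
  @convex_set R (R^o * R^o)%type A <->
  (forall u v (l : R), 0 <= l -> l <= 1 -> A u -> A v ->
     A (l * u.1 + (1 - l) * v.1, l * u.2 + (1 - l) * v.2)).
Proof.
split=> [h u v l l0 l1 Au Av|h u v l].
  by have := h u v (Itv01 l0 l1); rewrite !inE; apply.
by rewrite !inE => Au Av; exact: (h u v l%:num (ge0 l) (le1 l)).
Qed.

Lemma hull_sub A : @embed R @` A `<=` hull A.
Proof. exact: sub_gen_smallest. Qed.

Lemma hull_convex A : @convex_set R (R^o * R^o)%type (@hull R A).
Proof.
apply/convex_setP => u v l l0 l1 Au Av B BP.
have /convex_setP := BP.1; apply => //; [exact: Au|exact: Av].
Qed.

Lemma orient_conv p q u v (l : R) :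
  orient p q (l * u.1 + (1 - l) * v.1, l * u.2 + (1 - l) * v.2) =
  l * orient p q u + (1 - l) * orient p q v.
Proof. by rewrite /orient /=; ring. Qed.

(** Angles are measured from [p] and written as doubles of half angles, ready for the duplication
    formulas. *)
Lemma embed_base (p x : T) :
  embed x = (cos (2 * pi * coord p + (pi * arc_length p x) *+ 2),
             sin (2 * pi * coord p + (pi * arc_length p x) *+ 2)).
Proof.
have hx := coord_itv x; have hp := coord_itv p; have hl := arc_length_itv p x.
have [n En] : exists n : int, coord p + arc_length p x = coord x + n%:~R.
  by apply/circle_of_eq; rewrite circle_ofD (coordK p) (coordK x) arc_lengthK.
have : (-1)%:~R < n%:~R :> R by rewrite intrN; lra.
have : n%:~R < 2%:~R :> R by lra.
rewrite !ltr_int => h1 h2.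
have -> : 2 * pi * coord p + (pi * arc_length p x) *+ 2
        = 2 * pi * coord x + (pi *+ 2) * n%:~R.
  have -> : arc_length p x = coord x + n%:~R - coord p by lra.
  rewrite -[(pi * _) *+ 2]mulr_natl -[pi *+ 2]mulr_natl; ring.
have [->|->] : n = 0 \/ n = 1 by lia.
  by rewrite mulr0 addr0.
by rewrite mulr1 cosD2pi sinD2pi.
Qed.

(** In a triangle inscribed in the unit circle each side is twice the sine of half its central
    angle, and twice the area is half the product of the sides. *)
Lemma orient_embed (p q z : T) :
  orient (embed p) (embed q) (embed z) =
  - (4 * sin (pi * arc_length p z) * sin (pi * arc_length p q)
     * sin (pi * arc_length p q - pi * arc_length p z)).
Proof.
rewrite (embed_base p q) (embed_base p z) (embed_base p p) arc_length0 mulr0 mul0rn addr0.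
move: (2 * pi * coord p) (pi * arc_length p q) (pi * arc_length p z) => C V U.
rewrite /orient /= !(sinD C) !(cosD C) !sin_mulr2n !cos_mulr2n (sinD V) sinN cosN.
have h1' : cos C ^+ 2 = 1 - sin C ^+ 2 by have := cos2Dsin2 C; lra.
have h2' : cos U ^+ 2 = 1 - sin U ^+ 2 by have := cos2Dsin2 U; lra.
have h3' : cos V ^+ 2 = 1 - sin V ^+ 2 by have := cos2Dsin2 V; lra.
ring: h1' h2' h3'.
Qed.

Lemma orient_gt0 (p q z : T) : oarc q p z ->
  0 < orient (embed p) (embed q) (embed z).
Proof.
rewrite /oarc /= !(arc_length_base p q) arc_length0.
have hz := arc_length_itv p z; have hq := arc_length_itv p q.
rewrite orient_embed; move: hz hq.
move: (arc_length p q) (arc_length p z) => v u hu hv h.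
have pi0 := pi_gt0 R.
have [vu v0] : v < u /\ 0 < v.
  by case: (ltP u v) h => ? /=; case: (ltP 0 v) => ? /=; lra.
have s1 : 0 < sin (pi * u) by apply: sin_gt0_pi; nra.
have s2 : 0 < sin (pi * v) by apply: sin_gt0_pi; nra.
have s3 : 0 < sin (pi * u - pi * v) by apply: sin_gt0_pi; nra.
rewrite -(opprB (pi * u)) sinN mulrN opprK.
by rewrite !mulr_gt0.
Qed.

Lemma orient_le0 (p q z : T) : carc p q z ->
  orient (embed p) (embed q) (embed z) <= 0.
Proof.
rewrite /carc /= orient_embed.
have hz := arc_length_itv p z; have hq := arc_length_itv p q; move: hz hq.
move: (arc_length p q) (arc_length p z) => v u hu hv h.
have pi0 := pi_gt0 R.
have s1 : 0 <= sin (pi * u) by apply: sin_ge0_pi; nra.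
have s2 : 0 <= sin (pi * v) by apply: sin_ge0_pi; nra.
have s3 : 0 <= sin (pi * v - pi * u) by apply: sin_ge0_pi; nra.
by rewrite oppr_le0 !mulr_ge0.
Qed.

Lemma orientC u v w : orient u v w = - orient v u w.
Proof. by rewrite /orient; ring. Qed.

Lemma orient_cyc u v w : orient u v w = orient v w u.
Proof. by rewrite /orient; ring. Qed.

(** Relative to [p] and [q], the conditions [0 < orient] and [orient <= 0] define disjoint convex
    sets, each containing one of the hulls. *)
Lemma unlinked_arcs (p q : T) (A B : set T) :
  A `<=` oarc q p -> B `<=` carc p q -> unlinked A B.
Proof.
move=> Ap Bp; rewrite /unlinked -subset0 => z [hA hB].
suff: 0 < orient (embed p) (embed q) z /\ orient (embed p) (embed q) z <= 0 by lra.
split.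
  apply: (hA [set z | 0 < orient (embed p) (embed q) z]); split.
    apply/convex_setP => u v l l0 l1 /= hu hv; rewrite orient_conv.
    by case: (eqVneq l 0) => [->|ln]; [lra|nra].
  by move=> _ [x Ax <-] /=; apply: orient_gt0; exact: Ap.
apply: (hB [set z | orient (embed p) (embed q) z <= 0]); split.
  apply/convex_setP => u v l l0 l1 /= hu hv; rewrite orient_conv; nra.
by move=> _ [x Ax <-] /=; apply: orient_le0; exact: Bp.
Qed.

Lemma unlinked_sym (A B : set T) : unlinked A B -> unlinked B A.
Proof. by rewrite /unlinked setIC. Qed.
End Geometry.

(** * Arcs *)

(* [lra] rejects contexts containing equations between points of the circle. *)
Ltac clra := repeat match goal with
  | H : @eq ?A _ _ |- _ => let B := open_constr:(circle _) in unify A B; clear H end; lra.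

Section Arcs.
Variable R : realType.
Local Notation T := (circle R).
Local Notation pr := (@circle_of R).
Local Notation sg := (@sigma R).
Local Notation al := (@arc_length R).

(** The cases are the places where the base point can fall in the cyclic order [x], [z], [y]; cyclic
    order becomes linear arithmetic. *)
Lemma oarcE (e x y z : T) : oarc x y z <->
  [\/ al e x < al e z < al e y, al e z < al e y < al e x
    | al e y < al e x < al e z].
Proof.
have hx := arc_length_itv e x; have hy := arc_length_itv e y.
have hz := arc_length_itv e z.
rewrite /oarc /= !(arc_length_base e x); move: hx hy hz.
move: (al e x) (al e y) (al e z) => cx cy cz hx hy hz.
split=> [|[]h].
- case: (ltP cz cx) => h1; case: (ltP cy cx) => h2 /= h.
  + by constructor 2; lra.
  + by exfalso; lra.
  + by constructor 3; lra.
  + by constructor 1; lra.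
all: by case: (ltP cz cx) => h1; case: (ltP cy cx) => h2 /=; lra.
Qed.

Lemma oarc_asym (x y z : T) : oarc x y z -> ~ oarc y x z.
Proof.
by move=> /(oarcE x x y z) h /(oarcE x y x z) h'; case: h => h; case: h' => h'; lra.
Qed.

Lemma oarc_cover (x y z : T) : z <> x -> z <> y -> x <> y ->
  oarc x y z \/ oarc y x z.
Proof.
move=> zx zy xy.
have n u v : u <> v -> al x u != al x v.
  by move=> uv; apply/eqP => /arc_length_inj.
move: (n _ _ zx) (n _ _ zy) (n _ _ xy); rewrite arc_length0 => h1 h2 h3.
have := arc_length_itv x z; have := arc_length_itv x y => hy hz.
have z0 : 0 < al x z by rewrite lt_neqAle eq_sym h1; lra.
have y0 : 0 < al x y by rewrite lt_neqAle h3; lra.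
case: (ltgtP (al x z) (al x y)) h2 => // h _.
  by left; apply/(oarcE x); rewrite arc_length0; constructor 1; lra.
by right; apply/(oarcE x); rewrite arc_length0; constructor 3; lra.
Qed.

Lemma oarc_carc (x y z : T) : oarc x y z -> carc x y z.
Proof. by rewrite /oarc /carc /=; lra. Qed.

Lemma carcP (x y z : T) : ~ oarc y x z -> x <> y -> carc x y z.
Proof.
move=> h xy.
case: (pselect (z = x)) => [->|zx].
  by rewrite /carc /= arc_length0; have := arc_length_itv x y; lra.
case: (pselect (z = y)) => [->|zy]; first by rewrite /carc /=.
by case: (oarc_cover zx zy xy) => // /oarc_carc.
Qed.

Lemma oarc_neq (x y z : T) : oarc x y z -> x <> y.
Proof. by move=> + xy; rewrite xy /oarc/= arc_length0; lra. Qed.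

Lemma arc_length_from_antipode (e x : T) : al (antipode e) x =
  if al e x < 2^-1 then al e x + 2^-1 else al e x - 2^-1.
Proof.
have h := arc_length_itv e x.
have e1 : al e (antipode e) = 2^-1 by apply: arc_lengthP => //; lra.
rewrite (arc_length_base e) e1; case: ltP => /= ?; lra.
Qed.

Lemma arc_length_to_antipode (e x : T) : al e (antipode x) =
  if al e x < 2^-1 then al e x + 2^-1 else al e x - 2^-1.
Proof.
have h := arc_length_itv e x.
have E : antipode x = e + pr (al e x + 2^-1).
  by rewrite circle_ofD addrA arc_lengthK.
case: ltP => ?; first by apply: arc_lengthP; [clra|].
apply: arc_lengthP; first clra.
by rewrite E; congr (_ + _); apply/circle_of_eq; exists 1; clra.
Qed.

Lemma arc_length_antipode_r (e : T) : al e (antipode e) = 2^-1.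
Proof. by apply: arc_lengthP => //; lra. Qed.

Lemma arc_length_sigma (e x : T) : al (sg e) (sg x) =
  if al e x < 2^-1 then 2 * al e x else 2 * al e x - 1.
Proof.
have h := arc_length_itv e x.
have E : sg x = sg e + pr (2 * al e x).
  by rewrite -{1}(arc_lengthK e x) sigmaD /sigma -circle_ofMn mulr_natl.
case: ltP => ?; first by apply: arc_lengthP; [lra|].
apply: arc_lengthP; first lra.
rewrite E; congr (_ + _).
by apply/circle_of_eq; exists 1; lra.
Qed.

(** The branch of the inverse of [sigma] on the open half circle starting at [h]: it halves the
    distance from [sg h]. *)
Lemma half_lift (h y : T) : y <> sg h ->
  exists2 x, sg x = y & oarc h (antipode h) x.
Proof.
move=> yh; have b := arc_length_itv (sg h) y.
have c0 : al (sg h) y != 0.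
  by apply/eqP => E; apply: yh; apply: (@arc_length_inj _ (sg h)); rewrite E arc_length0.
have c1 : 0 < al (sg h) y by rewrite lt_neqAle eq_sym c0; lra.
exists (h + pr (al (sg h) y / 2)).
  rewrite sigmaD -[RHS](arc_lengthK (sg h)); congr (_ + _).
  by rewrite /sigma -circle_ofMn; congr pr; lra.
rewrite /oarc /= arc_length_antipode_r (@arc_lengthP _ h _ (al (sg h) y / 2)) //; lra.
Qed.

Lemma half_cover (h x : T) : x <> h -> x <> antipode h ->
  oarc h (antipode h) x \/ oarc (antipode h) h x.
Proof.
move=> x1 x2; apply: oarc_cover => // E.
by have := arc_length_antipode_r h; rewrite -E arc_length0; lra.
Qed.

(** Distances from [h] double without wrapping around, so cyclic order is kept. *)
Lemma oarc_sigma (h x y z : T) :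
  al h x < 2^-1 -> al h y < 2^-1 -> al h z < 2^-1 ->
  oarc (sg x) (sg y) (sg z) = oarc x y z.
Proof.
move=> hx hy hz; apply/propext.
rewrite (oarcE (sg h)) (oarcE h) !arc_length_sigma hx hy hz.
split=> -[]?; [constructor 1|constructor 2|constructor 3|constructor 1|constructor 2|constructor 3]; lra.
Qed.

(** The two preimages of [c] span a diameter; [h] ranges over its ends and thereby selects one of
    the two open half circles. *)
Definition same_half (c x y : T) : Prop :=
  exists2 h, sg h = c & oarc h (antipode h) x /\ oarc h (antipode h) y.

Lemma oarc_half (h x : T) : oarc h (antipode h) x <-> 0 < al h x < 2^-1.
Proof. by rewrite /oarc/= arc_length_antipode_r. Qed.

Lemma oarc_open (x y : T) : open (oarc x y).
Proof.
(* In the quotient topology a set is open when its preimage in the reals is. *)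
suff : open [set r : R | oarc x y (pr r)] by [].
rewrite openE => r /= h.
have E := arc_lengthK x (pr r).
set u := al x (pr r) in E; set v := al x y in h *.
have huv : 0 < u < v by exact: h.
have hv : v < 1 by have := arc_length_itv x y; rewrite -/v; lra.
exists (Num.min u (v - u)); first by rewrite /= lt_min; lra.
move=> s /=; rewrite lt_min => /andP[h1 h2].
have H : al x (pr s) = u + (s - r).
  move: h1 h2; rewrite !ltr_norml => h1 h2.
  apply: arc_lengthP; first lra.
  by rewrite circle_ofD addrA E -circle_ofD; congr pr; lra.
move: h1 h2; rewrite /oarc /= H -/v !ltr_norml; lra.
Qed.

Lemma nbhs_circle (x : T) (A : set T) : nbhs x A ->
  exists2 e : R, 0 < e & forall r, `|r| < e -> A (x + pr r).
Proof.
move=> Ax.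
have c : {for coord x, continuous (fun r : R => pr r : T)} by exact: pi_continuous.
have /c [e e0 he] : nbhs (pr (coord x)) A by rewrite coordK.
exists e => // r re; rewrite -(coordK x) -circle_ofD; apply: he => /=.
by rewrite opprD addrA subrr add0r normrN.
Qed.

End Arcs.

(** * A chord that crosses the interior of a hull *)

Section Crossing.
Variable R : realType.
Local Notation T := (circle R).
Implicit Types (u v w X Y : (R^o * R^o)%type) (x y z : T).

Definition sqnorm X : R := X.1 ^+ 2 + X.2 ^+ 2.

Lemma sqnorm_embed x : sqnorm (embed x) = 1.
Proof. by rewrite /sqnorm /embed /= cos2Dsin2. Qed.

Lemma sqnorm_conv X Y (l : R) : 0 <= l -> l <= 1 -> sqnorm X <= 1 -> sqnorm Y <= 1 ->
  sqnorm (l * X.1 + (1 - l) * Y.1, l * X.2 + (1 - l) * Y.2) <= 1.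
Proof.
move=> l0 l1 hX hY; have l1' : 0 <= 1 - l by lra.
have -> : sqnorm (l * X.1 + (1 - l) * Y.1, l * X.2 + (1 - l) * Y.2) =
   l * sqnorm X + (1 - l) * sqnorm Y
   - l * (1 - l) * ((X.1 - Y.1) ^+ 2 + (X.2 - Y.2) ^+ 2).
  by rewrite /sqnorm /=; ring.
have h1 : 0 <= l * (1 - l) * ((X.1 - Y.1) ^+ 2 + (X.2 - Y.2) ^+ 2).
  by rewrite !mulr_ge0 // addr_ge0 // sqr_ge0.
have h2 : l * sqnorm X <= l by rewrite ler_piMr.
have h3 : (1 - l) * sqnorm Y <= 1 - l by rewrite ler_piMr.
lra.
Qed.

(** If [u = l X + (1 - l) Y], then [sqnorm u = 1 - l (1 - l) N] with [N] the squared distance of [X]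
    and [Y]; in the disk this forces [l] into [[0, 1]]. *)
Lemma chord_of_line X Y u : sqnorm X = 1 -> sqnorm Y = 1 -> sqnorm u <= 1 ->
  X <> Y -> orient X Y u = 0 -> exists l : R, [/\ 0 <= l, l <= 1 &
    u = (l * X.1 + (1 - l) * Y.1, l * X.2 + (1 - l) * Y.2)].
Proof.
case: X Y u => [x1 x2] [y1 y2] [u1 u2] /=; rewrite /sqnorm /orient /= => hX hY hu XY h0.
pose N := (x1 - y1) ^+ 2 + (x2 - y2) ^+ 2.
have N0 : 0 < N.
  rewrite lt_neqAle addr_ge0 ?sqr_ge0 // andbT eq_sym paddr_eq0 ?sqr_ge0 //.
  rewrite !sqrf_eq0 !subr_eq0; apply/negP => /andP[/eqP e1 /eqP e2].
  by apply: XY; rewrite e1 e2.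
have Nn : N != 0 by rewrite gt_eqF.
(* The coefficient of the orthogonal projection of [u] to the line. *)
pose l := ((u1 - y1) * (x1 - y1) + (u2 - y2) * (x2 - y2)) / N.
have lN : l * N = (u1 - y1) * (x1 - y1) + (u2 - y2) * (x2 - y2) by rewrite divfK.
have e1 : u1 = l * x1 + (1 - l) * y1.
  apply: (mulfI Nn).
  have -> : N * (l * x1 + (1 - l) * y1) = N * y1 + (l * N) * (x1 - y1) by ring.
  rewrite lN /N; apply/eqP; rewrite -subr_eq0; apply/eqP.
  transitivity ((x2 - y2) * ((y1 - x1) * (u2 - x2) - (y2 - x2) * (u1 - x1))); first ring.
  by rewrite h0 mulr0.
have e2 : u2 = l * x2 + (1 - l) * y2.
  apply: (mulfI Nn).
  have -> : N * (l * x2 + (1 - l) * y2) = N * y2 + (l * N) * (x2 - y2) by ring.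
  rewrite lN /N; apply/eqP; rewrite -subr_eq0; apply/eqP.
  transitivity ((y1 - x1) * ((y1 - x1) * (u2 - x2) - (y2 - x2) * (u1 - x1))); first ring.
  by rewrite h0 mulr0.
exists l.
have ll : 0 <= l * (1 - l).
  have E : u1 ^+ 2 + u2 ^+ 2 = 1 - l * (1 - l) * N.
    rewrite e1 e2 /N.
    transitivity (l * (x1 ^+ 2 + x2 ^+ 2) + (1 - l) * (y1 ^+ 2 + y2 ^+ 2) - l * (1 - l) * N).
      by rewrite /N; ring.
    by rewrite hX hY /N; ring.
  rewrite -(pmulr_lge0 _ N0); lra.
by rewrite -e1 -e2; split=> //; nra.
Qed.

(** The open triangle if [u v w] is positively oriented, and empty otherwise. *)
Definition triangle u v w : set (R^o * R^o) :=
  [set X | [/\ 0 < orient u v X, 0 < orient v w X & 0 < orient w u X]].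

Lemma orient_continuous u v : continuous (fun X => orient u v X : R^o).
Proof.
move=> X; rewrite /orient.
apply: cvgB; apply: cvgMr.
  by apply: cvgB; [exact: cvg_snd|exact: cvg_cst].
by apply: cvgB; [exact: cvg_fst|exact: cvg_cst].
Qed.

Lemma triangle_open u v w : open (triangle u v w).
Proof.
have o (p q : (R^o * R^o)%type) : open [set X | 0 < orient p q X].
  have : open ((fun X => orient p q X : R^o) @^-1` [set y : R^o | 0 < y]).
    apply: open_comp; last exact: open_gt.
    by move=> X _; exact: orient_continuous.
  by [].
rewrite (_ : triangle u v w = [set X | 0 < orient u v X] `&`
  ([set X | 0 < orient v w X] `&` [set X | 0 < orient w u X])).
  by apply: openI => //; exact: openI.
by apply/seteqP; split=> X /=; [case|case=> ? []].
Qed.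

(** The three values of [orient], divided by their sum, are barycentric coordinates; [X] is reached
    by combining [v] with [w] and the result with [u]. *)
Lemma triangle_sub u v w (C : set (R^o * R^o)) :
  @convex_set R (R^o * R^o)%type C -> C u -> C v -> C w -> triangle u v w `<=` C.
Proof.
move=> /convex_setP cC Cu Cv Cw X [h1 h2 h3].
have D : orient u v w = orient v w X + orient w u X + orient u v X.
  by rewrite /orient; ring.
set o1 := orient v w X in h2 D; set o2 := orient w u X in h3 D; set o3 := orient u v X in h1 D.
have D0 : 0 < o1 + o2 + o3 by lra.
have D1 : o1 + o2 + o3 != 0 by rewrite gt_eqF.
have D2 : o2 + o3 != 0 by rewrite gt_eqF //; lra.
have b0 : 0 <= o2 / (o2 + o3) by apply: divr_ge0; lra.
have b1 : o2 / (o2 + o3) <= 1 by rewrite ler_pdivrMr; lra.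
have a0 : 0 <= o1 / (o1 + o2 + o3) by apply: divr_ge0; lra.
have a1 : o1 / (o1 + o2 + o3) <= 1 by rewrite ler_pdivrMr; lra.
have := cC _ _ _ a0 a1 Cu (cC _ _ _ b0 b1 Cv Cw).
have comb (p q r : R) : o1 / (o1 + o2 + o3) * p
    + (1 - o1 / (o1 + o2 + o3)) * (o2 / (o2 + o3) * q + (1 - o2 / (o2 + o3)) * r)
    = (o1 * p + o2 * q + o3 * r) / (o1 + o2 + o3) by field; rewrite D1.
rewrite /= !comb -D.
have Dn : orient u v w != 0 by rewrite D.
have -> : o1 * u.1 + o2 * v.1 + o3 * w.1 = X.1 * orient u v w.
  by rewrite /o1 /o2 /o3 /orient; ring.
have -> : o1 * u.2 + o2 * v.2 + o3 * w.2 = X.2 * orient u v w.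
  by rewrite /o1 /o2 /o3 /orient; ring.
by rewrite !mulfK //; case: X {D D0 D1 D2 b0 b1 a0 a1 comb h1 h2 h3 o1 o2 o3}.
Qed.

(** The segment from [x] to the midpoint of [y] and [y'] meets the line through [z] and [w]. The
    meeting point is interior to the triangle [x y y'], and it is on the chord since it lies in the
    disk. *)
Lemma chord_crossing (A B : set T) (z w x y y' : T) :
  A x -> A y -> A y' -> y <> y' -> B z -> B w ->
  oarc z w x -> oarc w z y -> oarc w z y' ->
  exists2 X, (hull A)^° X & hull B X.
Proof.
move=> Ax Ay Ay' yy' Bz Bw zx wy wy'.
have xy : y <> x by move=> E; apply: (oarc_asym zx); rewrite -E.
have xy' : y' <> x by move=> E; apply: (oarc_asym zx); rewrite -E.
wlog o : y y' Ay Ay' yy' wy wy' xy xy' / 0 < orient (embed x) (embed y) (embed y').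
  move=> W; case: (oarc_cover xy' (nesym yy') (nesym xy)) => /orient_gt0 o.
    apply: (W y' y) => //; first exact: nesym.
    by rewrite orient_cyc orient_cyc.
  by apply: (W y y').
have hA := @hull_convex R A; have hB := @hull_convex R B.
have sA t : A t -> hull A (embed t) by move=> At; apply: hull_sub; exists t.
have sB t : B t -> hull B (embed t) by move=> Bt; apply: hull_sub; exists t.
set Z := embed z; set W := embed w.
have gx : orient Z W (embed x) < 0 by rewrite orientC oppr_lt0; exact: orient_gt0.
have gy : 0 < orient Z W (embed y) by exact: orient_gt0.
have gy' : 0 < orient Z W (embed y') by exact: orient_gt0.
set u := embed x in o gx; set v := embed y in o gy; set v' := embed y' in o gy'.
pose m : R^o * R^o := (2^-1 * v.1 + (1 - 2^-1) * v'.1, 2^-1 * v.2 + (1 - 2^-1) * v'.2).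
have gm : 0 < orient Z W m by rewrite orient_conv; lra.
(* The zero of the affine function [orient Z W] on the segment from [m] to [u]. *)
pose l := orient Z W m / (orient Z W m - orient Z W u).
have d0 : 0 < orient Z W m - orient Z W u by lra.
have l0 : 0 < l by exact: divr_gt0.
have l1 : l < 1 by rewrite ltr_pdivrMr // mul1r; lra.
pose X : R^o * R^o := (l * u.1 + (1 - l) * m.1, l * u.2 + (1 - l) * m.2).
have gX : orient Z W X = 0.
  by rewrite orient_conv /l; field; rewrite gt_eqF.
have nm : sqnorm m <= 1 by apply: (@sqnorm_conv v v'); rewrite ?sqnorm_embed //; lra.
have nX : sqnorm X <= 1.
  by apply: (@sqnorm_conv u m); rewrite ?sqnorm_embed //; exact: ltW.
have ZW : Z <> W by move=> E; move: gy; rewrite E /orient; lra.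
have [t [t0 t1 Xt]] := chord_of_line (sqnorm_embed z) (sqnorm_embed w) nX ZW gX.
exists X; last first.
  by rewrite Xt; have /convex_setP := hB; apply => //; exact: sB.
have XT : triangle u v v' X.
  have oD (p q : (R^o * R^o)%type) : orient p q p = 0 /\ orient p q q = 0 by rewrite /orient;
    split; ring.
  have e1 : orient v v' u = orient u v v' by rewrite -orient_cyc.
  have e2 : orient v' u v = orient u v v' by rewrite orient_cyc.
  split; rewrite !orient_conv ?(oD _ _).1 ?(oD _ _).2 ?e1 ?e2; nra.
apply: (@filterS _ (nbhs X) _ (triangle u v v')); last first.
  by apply: open_nbhs_nbhs; split=> //; exact: triangle_open.
by apply: triangle_sub => //; exact: sA.
Qed.

End Crossing.

(** * The lamination of a backward invariant family of leaves *)

Section LeafLamination.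
Variable R : realType.
Local Notation T := (circle R).
Local Notation pr := (@circle_of R).
Local Notation sg := (@sigma R).
Local Notation al := (@arc_length R).
Variables (theta : T) (leaf : T -> T -> Prop).

(** A leaf is an ordered pair, whose order records the side [(q, p)] from which it is approximated;
    [uleaf] forgets the order. *)
Definition uleaf p q := leaf p q \/ leaf q p.

Definition sep x y := exists p q, [/\ uleaf p q, oarc p q x & oarc q p y].

Hypothesis leaf_half : forall p q, leaf p q -> same_half (sg theta) p q.
Hypothesis leaf_sigma : forall p q, leaf p q -> leaf (sg p) (sg q).
Hypothesis leaf_lift : forall p q,
  same_half (sg theta) p q -> leaf (sg p) (sg q) -> leaf p q.
Hypothesis leaf_crit : forall p q, leaf p q -> p <> sg theta /\ q <> sg theta.
Hypothesis leaf_neq : forall p q, leaf p q -> p <> q.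
(* Approximation of [{p, q}] from the side of [(q, p)]; it makes up for the fact
   that leaves are not assumed to be pairwise unlinked. *)
Hypothesis leaf_key : forall p q x, leaf p q -> oarc q p x ->
  exists r s, [/\ uleaf r s, oarc r s x, oarc s r p & oarc s r q].
(** Leaf ends are dense; this makes the classes nowhere dense. *)
Hypothesis leaf_dense : forall (x : T) (e : R), 0 < e ->
  exists (r : R) q, 0 < r < e /\ leaf (x + pr r) q.

Lemma uleaf_sym p q : uleaf p q -> uleaf q p.
Proof. by case; [right|left]. Qed.

Lemma same_half_sym (c p q : T) : same_half c p q -> same_half c q p.
Proof. by case=> h hc [hp hq]; exists h. Qed.

Lemma uleaf_lift p q :
  same_half (sg theta) p q -> uleaf (sg p) (sg q) -> uleaf p q.
Proof.
move=> h [l|l]; [left|right]; apply: leaf_lift => //; exact: same_half_sym.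
Qed.

Lemma uleaf_half p q : uleaf p q -> same_half (sg theta) p q.
Proof. by case=> /leaf_half => [//|/same_half_sym]. Qed.

Lemma uleaf_sigma p q : uleaf p q -> uleaf (sg p) (sg q).
Proof. by case=> /leaf_sigma; [left|right]. Qed.

Lemma uleaf_crit p q : uleaf p q -> p <> sg theta /\ q <> sg theta.
Proof. by case=> /leaf_crit[]. Qed.

Lemma sep_sym x y : sep x y -> sep y x.
Proof. by case=> p [q [l px qy]]; exists q, p; split=> //; exact: uleaf_sym. Qed.

Lemma sep_irr x : ~ sep x x.
Proof. by case=> p [q [_ /oarc_asym]]. Qed.

(** Only the case of [y] an end of the leaf between [x] and [z] is not immediate. Then the
    approximating leaf separates [y] from the point on its side, and [x] and [z] are swapped at the
    start so that this point is [z]. *)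
Lemma sep_trans y x z : sep x z -> sep x y \/ sep y z.
Proof.
wlog [p [q [l px qz]]] : x z / exists p q, [/\ leaf p q, oarc p q x & oarc q p z].
  move=> W; move=> [p [q [[l|l] px qz]]].
    by apply: W; exists p, q; split=> //; left.
  have [||/sep_sym h|/sep_sym h] := W z x _ _; [|by exists q, p; split=> //;
    left|by right|by left].
  by exists q, p.
move=> _.
have pq := oarc_neq px.
case: (pselect (oarc q p y)) => qy; first by left; exists p, q; split=> //; left.
case: (pselect (oarc p q y)) => py; first by right; exists p, q; split=> //; left.
have ypq : y = p \/ y = q.
  case: (pselect (y = p)) => yp; first by left.
  case: (pselect (y = q)) => yq; first by right.
  by case: (oarc_cover yp yq pq).
right; apply: sep_sym; have [r [s [rs h1 h2 h3]]] := leaf_key l qz.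
by exists r, s; split=> //; case: ypq => ->.
Qed.

Definition unsep x y := ~ sep x y.

Lemma unsep_equiv : Equivalence unsep.
Proof.
split.
- exact: sep_irr.
- by move=> x y h /sep_sym.
- by move=> x y z h1 h2 /(sep_trans y)[].
Qed.

Lemma sep_open x y : sep x y ->
  exists U V : set T, [/\ open U, open V, U x, V y & forall u v, U u -> V v -> sep u v].
Proof.
case=> p [q [l px qy]]; exists (oarc p q), (oarc q p); split=> //; try exact: oarc_open.
by move=> u v pu qv; exists p, q.
Qed.

Lemma unsep_closed : closed [set u : T * T | unsep u.1 u.2].
Proof.
rewrite (_ : [set u | _] = ~` [set u : T * T | sep u.1 u.2]); last by [].
apply: open_closedC; rewrite openE => -[x y] /= /sep_open[U [V [oU oV Ux Vy UV]]].
exists (U, V) => /=; first by split; exact: open_nbhs_nbhs.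
by move=> [u v] [/= Uu Vv]; exact: UV.
Qed.

Lemma unsep_class_closed x : closed (eqv_class unsep x).
Proof.
rewrite (_ : eqv_class _ _ = ~` [set y | sep x y]); last by [].
apply: open_closedC; rewrite openE => y /= /sep_open[U [V [oU oV Ux Vy UV]]].
apply: (@filterS _ (nbhs y) _ V); first by move=> v; exact: UV.
exact: open_nbhs_nbhs.
Qed.

(** An open set inside a class would contain points close to a leaf end on both sides of it, and
    that leaf separates them. *)
Lemma unsep_nowhere_dense x : nowhere_dense (eqv_class unsep x).
Proof.
rewrite /nowhere_dense -(closure_id _).1; last exact: unsep_class_closed.
rewrite -subset0 => y /nbhs_circle[e e0 he].
have e20 : 0 < e / 2 by lra.
have [r [q [r0 l]]] := leaf_dense y e20.
set p := y + pr r in l.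
have pq := leaf_neq l.
have v0 : 0 < al p q < 1.
  have := arc_length_itv p q; have : al p q != 0.
    by apply/eqP => E; apply: pq; apply: (@arc_length_inj _ p); rewrite E arc_length0.
  by move=> h1 /andP[h2 ->]; rewrite lt_neqAle eq_sym h1 h2.
(* Small enough that [p + d] and [p - d] stay near [y] and do not reach [q]. *)
pose d := Num.min (r / 2) (Num.min (al p q / 2) ((1 - al p q) / 2)).
have d0 : 0 < d by rewrite !lt_min; lra.
have : d <= r / 2 /\ d <= al p q / 2 /\ d <= (1 - al p q) / 2.
  by rewrite /d !ge_min !lexx ?orbT.
case=> d1 [d2 d3].
have sepd : sep (p + pr d) (p + pr (- d)).
  have ad : al p (p + pr d) = d by apply: arc_lengthP => //; lra.
  have ad' : al p (p + pr (- d)) = 1 - d.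
    apply: arc_lengthP; first lra.
    by congr (_ + _); apply/circle_of_eq; exists (-1); rewrite intrN; lra.
  exists p, q; split; first by left.
    by apply/(oarcE p); rewrite arc_length0 ad; constructor 1; lra.
  by apply/(oarcE p); rewrite arc_length0 ad'; constructor 3; lra.
have c1 : unsep x (p + pr d).
  rewrite /p -addrA -circle_ofD; apply: he; rewrite ger0_norm; lra.
have c2 : unsep x (p + pr (- d)).
  rewrite /p -addrA -circle_ofD; apply: he; rewrite ger0_norm; lra.
have [eR eS eT] := unsep_equiv.
by case: (eT _ _ _ (eS _ _ c1) c2).
Qed.

(** A leaf between the classes confines one of them to the closed arc [[p, q]]; the approximating
    leaf keeps the other one off [p] and [q], hence in the open arc [(q, p)]. *)
Lemma unsep_unlinked x y : eqv_class unsep x <> eqv_class unsep y ->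
  unlinked (eqv_class unsep x) (eqv_class unsep y).
Proof.
have [eR eS eT] := unsep_equiv.
move=> xy; have : sep x y.
  apply: contrapT => h; apply: xy; apply/seteqP; split=> z /= hz.
    by apply: eT hz; exact: eS.
  by apply: eT hz.
move=> {xy}; wlog [p [q [l px qy]]] : x y / exists p q, [/\ leaf p q, oarc p q x & oarc q p y].
  move=> W; move=> [p [q [[l|l] px qy]]].
    by apply: W; exists p, q; split=> //; left.
  by apply: unlinked_sym; apply: W; exists q, p; split=> //; left.
move=> _; apply: unlinked_sym.
have pq := oarc_neq px.
have [r [s [rs h1 h2 h3]]] := leaf_key l qy.
have ul : uleaf p q by left.
apply: (@unlinked_arcs _ p q) => z hz.
  case: (pselect (z = p)) => zp; first by case: hz; exists r, s; rewrite zp.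
  case: (pselect (z = q)) => zq; first by case: hz; exists r, s; rewrite zq.
  case: (oarc_cover zp zq pq) => // pz; case: hz.
  by exists q, p; split=> //; exact: uleaf_sym.
by apply: carcP => // qz; apply: hz; exists p, q.
Qed.

Lemma unsep_theta : unsep theta (antipode theta).
Proof.
suff N h p q : sg h = sg theta -> oarc h (antipode h) p -> oarc h (antipode h) q ->
   uleaf p q -> ~ ((oarc p q h /\ oarc q p (antipode h)) \/ (oarc p q (antipode h) /\ oarc q p h)).
  case=> p [q [l px qy]].
  have [h hc [hp hq]] := uleaf_half l.
  have [E|E] : theta = h \/ theta = antipode h by exact: sigma_eq.
    by apply: (N h p q) => //; left; rewrite -E.
  apply: (N h p q) => //; right; split; last by rewrite E antipodeK in qy.
  by rewrite -E.
move=> hc /oarc_half hp /oarc_half hq l.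
rewrite !(oarcE h) arc_length0 arc_length_antipode_r.
by move=> [[[]h1 []h2]|[[]h1 []h2]]; clra.
Qed.

(** Take the side [(p, q)] of the leaf that omits [sg theta], and lift the leaf to the half circle
    of the point [u] above that side. The lifted arc stays in the half circle and maps into
    [(p, q)], so it contains [u] but not [v]. *)
Lemma sep_sigma x y : sep (sg x) (sg y) -> sep x y.
Proof.
suff W p q u v : uleaf p q -> oarc p q (sg u) -> oarc q p (sg v) ->
  ~ oarc p q (sg theta) -> sep u v.
  case=> p [q [l px qy]].
  case: (pselect (oarc p q (sg theta))) => h.
    by apply: sep_sym; apply: (W q p) => //; [exact: uleaf_sym|exact: oarc_asym].
  exact: (W p q).
move=> l pu qv nt; have [pt qt] := uleaf_crit l.
have [h [hc hu]] : exists h, sg h = sg theta /\ oarc h (antipode h) u.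
  have uE h : sg h = sg theta -> u <> h by move=> E uh; apply: nt; rewrite -E -uh.
  case: (@half_cover _ theta u); [exact: uE|by apply: uE; rewrite sigma_antipode|..] => hu.
    by exists theta.
  by exists (antipode theta); rewrite sigma_antipode antipodeK.
rewrite -hc in pt qt.
have [ph pE hp] := half_lift pt; have [qh qE hq] := half_lift qt.
have lh : uleaf ph qh.
  by apply: uleaf_lift; [exists h|rewrite pE qE].
move/oarc_half: (hp) => hp'; move/oarc_half: (hq) => hq'; move/oarc_half: (hu) => hu'.
exists ph, qh; split=> //.
  by rewrite -(@oarc_sigma _ h) ?pE ?qE //; clra.
have puh : ~ oarc ph qh v.
  move=> hv; case: (@oarc_asym _ q p (sg v)) => //.
  have hv' : al h v < 2^-1.
    have nt' : ~ oarc ph qh h.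
      move=> H; apply: nt; rewrite -hc -pE -qE.
      rewrite (@oarc_sigma _ h) // ?arc_length0; clra.
    move: hv nt'; rewrite !(oarcE h) arc_length0 => -[]H nt'; try clra.
    by case: nt'; constructor 2; clra.
  rewrite -pE -qE (@oarc_sigma _ h) //; clra.
have vp : v <> ph by move=> vp; move: qv; rewrite vp pE /oarc /=; clra.
have vq : v <> qh by move=> vq; move: qv; rewrite vq qE /oarc /= arc_length0; clra.
have pqh : ph <> qh by move=> E; have := oarc_neq pu; rewrite -pE -qE E.
by case: (oarc_cover vp vq pqh).
Qed.

(** Lift [y] to the closed half circle of [x]. A leaf separating [x] from the lift has its ends in
    that half circle, and its image then separates the images. *)
Lemma unsep_sigma_lift x y : unsep (sg x) y -> exists2 z, sg z = y & unsep x z.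
Proof.
move=> xy.
have [h [z [hc zE hx hz]]] : exists h z, [/\ sg h = sg theta, sg z = y,
    al h x <= 2^-1 & al h z <= 2^-1].
  have [h [hc hx]] : exists h, sg h = sg theta /\ al h x <= 2^-1.
    case: (leP (al theta x) 2^-1) => h; first by exists theta.
    exists (antipode theta); rewrite sigma_antipode arc_length_from_antipode.
    have := arc_length_itv theta x; split=> //; case: ltP; clra.
  case: (pselect (y = sg h)) => yt.
    by exists h, h; rewrite arc_length0; split=> //; clra.
  by have [z zE /oarc_half hz] := half_lift yt; exists h, z; split=> //; clra.
exists z => // -[p [q [l px qz]]]; apply: xy; rewrite -zE.
have [g gc [/oarc_half hp /oarc_half hq]] := uleaf_half l.
have [E|E] : g = h \/ g = antipode h by apply: sigma_eq; rewrite gc hc.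
  rewrite E {g gc E} in hp hq *.
  have bx := arc_length_itv h x; have bz := arc_length_itv h z.
  exists (sg p), (sg q); split; first exact: uleaf_sigma.
    move: px; rewrite (oarcE h) (oarcE (sg h)) !arc_length_sigma.
    have -> : al h p < 2^-1 by clra.
    have -> : al h q < 2^-1 by clra.
    by case: (ltP (al h x) 2^-1) => H -[]?;
      first [constructor 1; clra|constructor 2; clra|constructor 3; clra].
  move: qz; rewrite (oarcE h) (oarcE (sg h)) !arc_length_sigma.
  have -> : al h p < 2^-1 by clra.
  have -> : al h q < 2^-1 by clra.
  by case: (ltP (al h z) 2^-1) => H -[]?;
    first [constructor 1; clra|constructor 2; clra|constructor 3; clra].
exfalso; move: hp hq; rewrite E !arc_length_from_antipode.
have bp := arc_length_itv h p; have bq := arc_length_itv h q.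
have bx := arc_length_itv h x; have bz := arc_length_itv h z.
move: px qz; rewrite !(oarcE h).
by case: (ltP (al h p) 2^-1) => ?; case: (ltP (al h q) 2^-1) => ?; move=> []? []? ? ?; clra.
Qed.

Lemma unsep_lamination p q : leaf p q ->
  exists E : T -> T -> Prop,
    [/\ invariant_lamination E, ~ degenerate E & E theta (antipode theta)].
Proof.
move=> l; exists unsep; split; last exact: unsep_theta.
- split.
    split; [exact: unsep_equiv|exact: unsep_closed|exact: unsep_nowhere_dense|].
    exact: unsep_unlinked.
  move=> x; exists (sg x); apply/seteqP; split=> y /=.
    by move=> [z xz <-] /sep_sigma.
  by move=> /unsep_sigma_lift[z zE xz]; exists z.
- move=> D; have := leaf_neq l => pq.
  have v0 : 0 < al p q < 1.
    have := arc_length_itv p q; have : al p q != 0.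
      by apply/eqP => E; apply: pq; apply: (@arc_length_inj _ p); rewrite E arc_length0.
    by move=> h1 /andP[h2 ->]; rewrite lt_neqAle eq_sym h1 h2.
  (* The midpoints of the two arcs between [p] and [q]. *)
  apply: (D (p + pr (al p q / 2)) (p + pr ((1 + al p q) / 2))).
  exists p, q; split; first by left.
    have a1 : al p (p + pr (al p q / 2)) = al p q / 2.
      by apply: arc_lengthP => //; clra.
    by apply/(oarcE p); rewrite arc_length0 a1; constructor 1; clra.
  have a2 : al p (p + pr ((1 + al p q) / 2)) = (1 + al p q) / 2.
    by apply: arc_lengthP => //; clra.
  by apply/(oarcE p); rewrite arc_length0 a2; constructor 3; clra.
Qed.

End LeafLamination.

(** * Preimages of the main leaf *)

(** The order of the base pair puts [D] on the side [(a', b)], from which the leaves approximate. *)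
Inductive pullback (R : realType) (c b a' : circle R) : circle R -> circle R -> Prop :=
| pullback_base : pullback c b a' b a'
| pullback_step p q : same_half c p q -> pullback c b a' (sigma p) (sigma q) ->
    pullback c b a' p q.

Section Core.
Variable R : realType.
Local Notation T := (circle R).
Local Notation pr := (@circle_of R).
Local Notation sg := (@sigma R).
Local Notation al := (@arc_length R).

Lemma iter_sigma_shift (x : T) (r : R) j :
  iter j sg (x + pr r) = iter j sg x + pr (2 ^+ j * r).
Proof. by rewrite iter_sigmaD iter_sigma_pr. Qed.

(** Coordinates with origin [a]: [theta] is at [tau], and [delta] is the length that [sigma^k]
    stretches to [L]. *)
Variables (a : T) (L tau : R) (k : nat).
Local Notation P s := (a + pr s).
Local Notation b := (P L).
Local Notation a' := (antipode a).
Local Notation theta := (P tau).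
Local Notation delta := (L / 2 ^+ k).
Local Notation leaf := (pullback (sg theta) b a').
Local Notation uleaf := (@uleaf R leaf).

(* [a + [0, L]] is [I]; adding [eps true = 1/2] goes from [I] to [I'], so that the
   bit [c] selects one of two antipodal arcs. *)
Definition eps (c : bool) : R := if c then 2^-1 else 0.

(** The closed main holes: [[b, a']] for [false], [[b', a]] for [true]. *)
Definition hole (c : bool) (z : T) :=
  exists2 d, L <= d <= 2^-1 & z = P (d + eps c).

Definition piece (s : R) := 0 <= s <= delta \/ L - delta <= s <= L.

(* The set [H] in these coordinates. *)
Definition pieces (z : T) := exists s c, piece s /\ z = P (s + eps c).

Hypothesis tauL : 0 < tau < L.
Hypothesis L2 : L < 2^-1.
Ltac slra := have ? := tauL; have ? := L2; clra.
Hypothesis k0 : (0 < k)%N.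
Hypothesis per_b : iter k sg b = b.
Hypothesis per_a' : iter k sg a' = a'.
Hypothesis nper_b : forall j, (0 < j < k)%N -> iter j sg b <> b.
Hypothesis nper_a' : forall j, (0 < j < k)%N -> iter j sg a' <> a'.
Hypothesis holes : forall j, (0 < j < k)%N ->
  exists c, hole c (iter j sg b) /\ hole c (iter j sg a').
Hypothesis crit_periodic : is_periodic (sg theta).
Hypothesis escape : exists i, ~ pieces (iter (k * i) sg theta).

(** * The orbit of the main leaf and its preimages *)

Lemma iter_eps j s c : (0 < j)%N -> iter j sg (P (s + eps c)) = iter j sg (P s).
Proof.
move=> j0; rewrite circle_ofD addrA; case: c; rewrite /eps; last first.
  by rewrite circle_of0 addr0.
exact: iter_sigma_antipode.
Qed.

Lemma shift_inj r s : 0 <= r < 1 -> 0 <= s < 1 -> P r = P s -> r = s.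
Proof.
move=> hr hs E.
by rewrite -(@arc_lengthP _ a (P r) r hr erefl) E (@arc_lengthP _ a (P s) s hs erefl).
Qed.

Lemma shift_period r : P (r + 1) = P r.
Proof. by rewrite circle_ofD circle_of1 addr0. Qed.

Lemma pow2_gt0 j : 0 < 2 ^+ j :> R.
Proof. exact: exprn_gt0. Qed.

Lemma delta_bounds : 0 < delta <= L / 2.
Proof.
have p0 := pow2_gt0 k; apply/andP; split; first (apply: divr_gt0; [slra|done]).
rewrite ler_pM2l; last slra.
rewrite lef_pV2 ?posrE //.
by rewrite -[X in X <= _]expr1 ler_eXn2l // ltr1n.
Qed.

Lemma deltaK : 2 ^+ k * delta = L.
Proof. by rewrite mulrC divfK // gt_eqF // pow2_gt0. Qed.

Lemma arc_length_shift r u : 0 <= u - r < 1 -> al (P r) (P u) = u - r.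
Proof.
move=> h; apply: arc_lengthP => //.
by rewrite -addrA -circle_ofD addrCA subrr addr0.
Qed.

Lemma same_half_shift u v r : sg (P r) = sg theta -> r < u < r + 2^-1 -> r < v < r + 2^-1 ->
  same_half (sg theta) (P u) (P v).
Proof.
move=> E hu hv; exists (P r) => //.
by split; apply/oarc_half; rewrite arc_length_shift; slra.
Qed.

(** The ends of the diameter are interior to [I] and [I'], so it cuts no main hole. *)
Lemma hole_half c z w : hole c z -> hole c w -> same_half (sg theta) z w.
Proof.
case=> d hd -> [d' hd' ->]; apply: (@same_half_shift _ _ (tau + eps c)); [|slra|slra].
exact: (@iter_eps 1).
Qed.

Lemma hole_b : hole false b.
Proof. by exists L; [slra|rewrite /eps addr0]. Qed.

Lemma hole_a' : hole false a'.
Proof. by exists 2^-1; [slra|rewrite /eps addr0]. Qed.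

Lemma iter_mod j (x : T) : iter k sg x = x -> iter j sg x = iter (j %% k) sg x.
Proof.
move=> E; rewrite {1}(divn_eq j k) addnC iterD; congr (iter _ _ _).
by elim: (j %/ k)%N => //= n IH; rewrite mulSn iterD IH E.
Qed.

Lemma orbit_holes j : exists c, hole c (iter j sg b) /\ hole c (iter j sg a').
Proof.
rewrite (iter_mod j per_b) (iter_mod j per_a').
case: (posnP (j %% k)) => [->|j0]; last by apply: holes; rewrite j0 ltn_mod.
by exists false; split; [exact: hole_b|exact: hole_a'].
Qed.

Lemma pullback_iter n p q :
  (forall j, (j < n)%N -> same_half (sg theta) (iter j sg p) (iter j sg q)) ->
  leaf (iter n sg p) (iter n sg q) -> leaf p q.
Proof.
elim: n p q => // n IH p q h; rewrite !iterSr => l.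
apply: pullback_step; first exact: (h 0%N).
by apply: IH => // j jn; rewrite -!iterSr; apply: h.
Qed.

Lemma leaf_half p q : leaf p q -> same_half (sg theta) p q.
Proof. by case=> //; exact: hole_half hole_b hole_a'. Qed.

(** The orbit of the main leaf stays in main holes, so the image of the main leaf is itself a
    preimage of it of order [k - 1]. *)
Lemma leaf_sigma p q : leaf p q -> leaf (sg p) (sg q).
Proof.
case=> // ; apply: (@pullback_iter k.-1).
  by move=> j _; rewrite -!iterSr; have [c [h1 h2]] := orbit_holes j.+1; exact: hole_half h1 h2.
by rewrite -!iterSr prednK // per_b per_a'; exact: pullback_base.
Qed.

Lemma leaf_orbit p q : leaf p q -> exists n, iter n sg p = b /\ iter n sg q = a'.
Proof.
elim=> [|{}p {}q _ _ [n [h1 h2]]]; first by exists 0%N.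
by exists n.+1; rewrite !iterSr.
Qed.

Lemma hole_theta c : ~ hole c theta /\ ~ hole c (antipode theta).
Proof.
split=> -[d hd].
  case: c; rewrite /eps ?addr0 => E.
    case: (ltP d 2^-1) => d2; first by have : tau = d + 2^-1; [apply: shift_inj => //;
      slra|slra].
    (* Here [d = 1/2] and the bit is set: [P] makes a full turn, back to [a]. *)
    have E' : P tau = P 0 by rewrite E -(shift_period 0); congr (a + pr _); slra.
    by have : tau = 0; [apply: shift_inj E'; slra|slra].
  by have : tau = d; [apply: shift_inj => //; slra|slra].
rewrite /antipode -addrA -circle_ofD; case: c; rewrite /eps ?addr0 => E.
  case: (ltP d 2^-1) => d2; first by have : tau + 2^-1 = d + 2^-1; [apply: shift_inj => //;
    slra|slra].
  have E' : P (tau + 2^-1) = P 0 by rewrite E -(shift_period 0); congr (a + pr _); slra.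
  by have : tau + 2^-1 = 0; [apply: shift_inj E'; slra|slra].
by have : tau + 2^-1 = d; [apply: shift_inj => //; slra|slra].
Qed.

(** Otherwise, [sg theta] being periodic, the orbit of [x] would return to it through [theta] or
    [theta'], which are in no closed main hole. *)
Lemma crit_orbit n x : x = b \/ x = a' -> iter n sg (sg theta) <> x.
Proof.
move=> xE E; have [N N0 EN] := crit_periodic.
have EM m : iter (m * N) sg (sg theta) = sg theta.
  by elim: m => // m IH; rewrite mulSn iterD IH EN.
have nM : (n < n.+1 * N)%N by rewrite -[X in (X <= _)%N]muln1 leq_mul2l N0 orbT.
have [i Ei] : exists i, (n.+1 * N = i.+1 + n)%N by exists (n.+1 * N - n).-1; lia.
have {EM} := EM n.+1; rewrite Ei iterD E iterS => /sigma_eq.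
have [c [h1 h2]] := orbit_holes i.
have [c' h] : exists c, hole c (iter i sg x).
  by case: xE => ->; exists c.
have [n1 n2] := hole_theta c'.
by case=> E'; [apply: n1|apply: n2]; rewrite -E'.
Qed.

Lemma leaf_crit p q : leaf p q -> p <> sg theta /\ q <> sg theta.
Proof.
move=> /leaf_orbit[n [pb qa]]; split=> E.
  by apply: (@crit_orbit n b); [left|rewrite -E].
by apply: (@crit_orbit n a'); [right|rewrite -E].
Qed.

Lemma b_neq_a' : b <> a'.
Proof. by move=> E; have : L = 2^-1; [apply: shift_inj => //; slra|slra]. Qed.

Lemma leaf_neq p q : leaf p q -> p <> q.
Proof.
by move=> /leaf_orbit[n [pb qa]] E; apply: b_neq_a'; rewrite -pb -qa E.
Qed.

(** Leaves lift to the half circle of [p] because none ends at [sg theta]. *)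
Lemma exists_leaf n p : iter n sg p = b -> exists q, leaf p q.
Proof.
elim: n p => [p /= ->|n IH p]; first by exists a'; exact: pullback_base.
rewrite iterSr => /IH[q1 l]; have [pt qt] := leaf_crit l.
have [h hc hp] : exists2 h, sg h = sg theta & oarc h (antipode h) p.
  case: (@half_cover _ theta p) => [E|E|h|h].
  - by apply: pt; rewrite E.
  - by apply: pt; rewrite E sigma_antipode.
  - by exists theta.
  - by exists (antipode theta); rewrite ?sigma_antipode ?antipodeK.
rewrite -hc in qt; have [q qE hq] := half_lift qt.
by exists q; apply: pullback_step; [exists h|rewrite qE].
Qed.

Lemma pow2_small (e : R) : 0 < e -> exists n, 1 / 2 ^+ n < e.
Proof.
move=> e0; exists (Num.bound (1 / e)); rewrite ltr_pdivrMr ?pow2_gt0 // mulrC -ltr_pdivrMr //.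
apply: (@lt_trans _ _ (Num.bound (1 / e))%:R).
  by apply: archi_boundP; rewrite divr_ge0 // ltW.
by rewrite -natrX ltr_nat ltn_expl.
Qed.

Lemma leaf_dense (x : T) (e : R) : 0 < e -> exists (r : R) q, 0 < r < e /\ leaf (x + pr r) q.
Proof.
move=> e0; have [|n hn] := @pow2_small (e / 2); first slra.
have hb := arc_length_itv (iter n sg x) b; set l := al _ b in hb.
have p0 := pow2_gt0 n.
(* A preimage of [b] of order [n]; the full turn added to [l] makes the offset positive. *)
have [q lq] : exists q, leaf (x + pr ((l + 1) / 2 ^+ n)) q.
  apply: (@exists_leaf n); rewrite iter_sigma_shift mulrC divfK ?gt_eqF //.
  by rewrite circle_ofD circle_of1 addr0 arc_lengthK.
exists ((l + 1) / 2 ^+ n), q; split=> //.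
rewrite divr_gt0 /=; [|slra|slra].
rewrite ltr_pdivrMr //; move: hn; rewrite ltr_pdivrMr //; nra.
Qed.


(** * Lifting leaves through [sigma^k] *)

Lemma shift_eq r s : P r = P s -> exists n : int, r - s = n%:~R.
Proof. by move=> /addrI/circle_of_eq[n ->]; exists n; rewrite addrC addKr. Qed.

(* Otherwise [sigma^(k - j) b] or [sigma^(k - j) a'] would be interior to [D]. *)
Lemma piece_hole j : (0 < j < k)%N ->
  exists c, forall s, piece s -> hole c (iter j sg (P s)).
Proof.
move=> jk; have [j0 jk'] := andP jk.
have [c [[d1 hd1 E1] [d2 hd2 E2]]] := holes jk.
have kj0 : (0 < k - j)%N by rewrite subn_gt0.
have kjk : (0 < k - j < k)%N by rewrite kj0 /= ltn_subrL j0 k0.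
have [c' [[e1 he1 F1] [e2 he2 F2]]] := holes kjk.
have A0 := pow2_gt0 j; have B0 := pow2_gt0 (k - j).
have AB : 2 ^+ (k - j) * 2 ^+ j = 2 ^+ k :> R by rewrite -exprD subnK // ltnW.
have dK : 2 ^+ (k - j) * (2 ^+ j * delta) = L by rewrite mulrA AB deltaK.
exists c => s [] hs.
- have Es : iter j sg (P s) = P (d2 + 2 ^+ j * s + eps c).
    rewrite iter_sigma_shift -(iter_sigma_antipode _ j0) E2 -addrA -circle_ofD.
    by congr (a + pr _); ring.
  exists (d2 + 2 ^+ j * s) => //.
  have s0 : 0 <= 2 ^+ j * s by apply: mulr_ge0; [exact: ltW|slra].
  have sd : 2 ^+ j * s <= 2 ^+ j * delta by rewrite ler_pM2l //; slra.
  (* Past 1/2, [sigma^(k - j) a'] would be in [[a', b')], which meets the closed main holes in [a']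
     alone, against the least period. *)
  case: (leP (d2 + 2 ^+ j * s) 2^-1) => h; first slra.
  have := iterD (k - j) j sg a'; rewrite subnK 1?ltnW // per_a' E2 iter_eps //.
  have -> : P d2 = a' + pr (d2 - 2^-1).
    by rewrite /antipode -addrA -circle_ofD; congr (a + pr _); ring.
  rewrite iter_sigma_shift F2.
  set y := 2 ^+ (k - j) * (2^-1 - d2).
  have y0 : 0 <= y by apply: mulr_ge0; [exact: ltW|slra].
  have yL : y < L.
    by rewrite -[X in _ < X]dK /y ltr_pM2l //; slra.
  rewrite -addrA -circle_ofD => E; have {E}[n En] := shift_eq E.
  have yE : 2 ^+ (k - j) * (d2 - 2^-1) = - y by rewrite /y -mulrN; congr (_ * _); ring.
  rewrite yE in En.
  case: c' F1 F2 En => F1 F2; rewrite /eps => En; have := int_small _ En => H; exfalso.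
    by have := H _; slra.
  have e2E : e2 = 2^-1 by have := H _; slra.
  by apply: (nper_a' kjk); rewrite F2 e2E /eps addr0.
- have Es : iter j sg (P s) = P (d1 - 2 ^+ j * (L - s) + eps c).
    have -> : P s = b + pr (s - L) by rewrite -addrA -circle_ofD; congr (a + pr _); ring.
    rewrite iter_sigma_shift E1 -addrA -circle_ofD.
    by congr (a + pr _); ring.
  exists (d1 - 2 ^+ j * (L - s)) => //.
  have s0 : 0 <= 2 ^+ j * (L - s) by apply: mulr_ge0; [exact: ltW|slra].
  have sd : 2 ^+ j * (L - s) <= 2 ^+ j * delta by rewrite ler_pM2l //; slra.
  (* Below [L], [sigma^(k - j) b] would likewise be in [(a, b]], hence equal to [b]. *)
  case: (leP L (d1 - 2 ^+ j * (L - s))) => h; first slra.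
  have := iterD (k - j) j sg b; rewrite subnK 1?ltnW // per_b E1 iter_eps //.
  have -> : P d1 = b + pr (d1 - L).
    by rewrite -addrA -circle_ofD; congr (a + pr _); ring.
  rewrite iter_sigma_shift F1.
  set y := 2 ^+ (k - j) * (d1 - L).
  have y0 : 0 <= y by apply: mulr_ge0; [exact: ltW|slra].
  have yL : y < L.
    by rewrite -[X in _ < X]dK /y ltr_pM2l //; slra.
  rewrite -addrA -circle_ofD => E; have {E}[n En] := shift_eq E.
  case: c' F1 F2 En => F1 F2; rewrite /eps => En; have := int_small _ En => H; exfalso.
    by have := H _; slra.
  have e1E : e1 = L by have := H _; slra.
  by apply: (nper_b kjk); rewrite F1 e1E /eps addr0.
Qed.

Lemma uleaf_iter n p q :
  (forall j, (j < n)%N -> same_half (sg theta) (iter j sg p) (iter j sg q)) ->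
  uleaf (iter n sg p) (iter n sg q) -> uleaf p q.
Proof.
move=> h [l|l]; [left|right]; apply: pullback_iter l => // j jn.
exact/same_half_sym/h.
Qed.

(** At the times strictly between 0 and [k] both points are in a common main hole by [piece_hole];
    only time 0 needs [same_half]. *)
Lemma uleaf_pieces r s c d : piece r -> piece s ->
  same_half (sg theta) (P (r + eps c)) (P (s + eps d)) ->
  uleaf (iter k sg (P r)) (iter k sg (P s)) ->
  uleaf (P (r + eps c)) (P (s + eps d)).
Proof.
move=> hr hs h l; apply: (@uleaf_iter k); last by rewrite !iter_eps.
case=> [//|j] jk.
have [e he] : exists c, forall s, piece s -> hole c (iter j.+1 sg (P s)).
  exact: piece_hole.
by rewrite !iter_eps //; apply: hole_half (he _ hr) (he _ hs).
Qed.

Lemma eps_theta c : sg (P (tau + eps c)) = sg theta.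
Proof. exact: (@iter_eps 1). Qed.

Lemma same_half_side r s c : 0 <= r <= L -> 0 <= s <= L ->
  (r < tau /\ s < tau) \/ (tau < r /\ tau < s) ->
  same_half (sg theta) (P (r + eps c)) (P (s + eps c)).
Proof.
move=> hr hs [] h.
  (* The half circle ending at [tau] starts half a turn earlier; a full turn is added to reach it
     from [tau + 1/2]. *)
  rewrite -(shift_period (r + _)) -(shift_period (s + _)).
  apply: (@same_half_shift _ _ (tau + 2^-1 + eps c)); [|slra|slra].
  by transitivity (sg (P (tau + eps true))); [exact: (@iter_eps 1)|exact: eps_theta].
by apply: (@same_half_shift _ _ (tau + eps c)); [exact: eps_theta|slra|slra].
Qed.

Lemma same_half_cross r s : 0 <= r <= L -> 0 <= s <= L -> r < tau < s ->
  same_half (sg theta) (P (s + eps false)) (P (r + eps true)).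
Proof.
move=> hr hs h; apply: (@same_half_shift _ _ tau) => //; rewrite /eps; slra.
Qed.

(* A leaf that separates the diameter of [theta] from the main leaf. *)
Definition good_leaf := exists u v,
  [/\ uleaf (P u) (P v), tau < u < L & 2^-1 < v < 2^-1 + tau].

(** The invariant carried backwards along the orbit of [theta]; asking for both bits frees it from
    the choice between [I] and [I']. *)
Definition caught z := exists r s t c,
  [/\ [/\ 0 < r, r < t, t < s & s < L], z = P (t + eps c) &
      forall c', uleaf (P (r + eps c')) (P (s + eps c'))].

Lemma uleaf_iter_crit r s : uleaf (iter k sg (P r)) (iter k sg (P s)) ->
  r <> tau /\ s <> tau.
Proof.
have W x y z : uleaf (iter k sg x) (iter k sg y) -> z = x \/ z = y -> z <> theta.
  move=> l E zt; have {l} [n ]: exists n, iter n sg (iter k sg z) = b \/ iter n sg (iter k sg z) = a'.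
    by case: l => /leaf_orbit[n [h1 h2]]; exists n; case: E => ->; tauto.
  rewrite zt -iterD -(prednK k0) addnS iterSr => H.
  by case: H; apply: crit_orbit; tauto.
by move=> l; split=> E; apply: (W _ _ theta l) => //; [left|right]; rewrite E.
Qed.

(** If [theta] is between [r] and [s], the lift joins [s] in [I] to [r] in [I'] and is a good leaf.
    Otherwise it joins [r] to [s] within each arc, around [t]. *)
Lemma caught_pullback r s t c : 0 < r -> r < t -> t < s -> s < L ->
  piece r -> piece s -> uleaf (iter k sg (P r)) (iter k sg (P s)) ->
  good_leaf \/ caught (P (t + eps c)).
Proof.
move=> r0 rt ts sL hr hs l; have [nr ns] := uleaf_iter_crit l.
have {nr} nr : r != tau by apply/eqP.
have {ns} ns : s != tau by apply/eqP.
case: (boolP (r < tau < s)) => h; [left|right].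
  exists s, (r + 2^-1); split; [|slra|slra].
  rewrite -[s]addr0; apply: (@uleaf_pieces s r false true) => //; last exact/uleaf_sym.
  by apply: same_half_cross; slra.
exists r, s, t, c; split=> // c'; apply: uleaf_pieces => //.
apply: same_half_side; [slra|slra|].
move: h; rewrite negb_and -!leNgt => /orP[] h; [right|left].
  by have tr : tau < r by [rewrite lt_neqAle eq_sym nr]; split; slra.
by have st : s < tau by [rewrite lt_neqAle ns]; split; slra.
Qed.

(** [sigma^k] sends [a] and [a'] to its fixed point [a'], so it stretches the low ends of [I] and
    [I'] over [I']. *)
Lemma iter_k_low s c : iter k sg (P (s + eps c)) = P (2 ^+ k * s + eps true).
Proof.
rewrite iter_eps // iter_sigma_shift -(iter_sigma_antipode _ k0) per_a' /antipode -addrA -circle_ofD.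
by congr (a + pr _); rewrite addrC.
Qed.

(** Likewise the high ends are stretched over [I], up to the fixed point [b]. *)
Lemma iter_k_high s c :
  iter k sg (P (s + eps c)) = P (L - 2 ^+ k * (L - s) + eps false).
Proof.
have E : P s = b + pr (s - L) by rewrite -addrA -circle_ofD; congr (a + pr _); ring.
rewrite iter_eps // E iter_sigma_shift per_b -addrA -circle_ofD.
by congr (a + pr _); rewrite /eps; ring.
Qed.

Lemma iter_k_low0 s : iter k sg (P s) = P (2 ^+ k * s + eps true).
Proof. by rewrite -(iter_k_low s false) iter_eps. Qed.

Lemma iter_k_high0 s : iter k sg (P s) = P (L - 2 ^+ k * (L - s)).
Proof. by rewrite -(iter_eps s false k0) iter_k_high addr0. Qed.

Lemma shift_eps_inj r s c d : 0 <= r <= L -> 0 <= s <= L ->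
  P (r + eps c) = P (s + eps d) -> r = s /\ c = d.
Proof.
move=> hr hs E; have : r + eps c = s + eps d.
  by apply: shift_inj E; case: (c); case: (d); rewrite /eps; slra.
by case: (c); case: (d); rewrite /eps => H; split=> //; try slra; exfalso; slra.
Qed.

(** Induction on the exit time [n]. At exit the point is in a gap between two pieces, whose ends
    [sigma^k] maps to [b'] and [a]; before that, the leaf around its image is pulled back. *)
Lemma escape_caught n s c : 0 <= s <= L ->
  (forall i, (i < n)%N -> pieces (iter (k * i) sg (P (s + eps c)))) ->
  ~ pieces (iter (k * n) sg (P (s + eps c))) ->
  good_leaf \/ caught (P (s + eps c)).
Proof.
have [d0 dL] := andP delta_bounds.
have K0 := pow2_gt0 k; have dK := deltaK.
elim: n s c => [|n IH] s c hs h.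
  rewrite muln0 /= => N.
  have hs' : delta < s < L - delta.
    have ns1 : ~ (0 <= s <= delta) by move=> H; apply: N; exists s, c; split=> //; left.
    have ns2 : ~ (L - delta <= s <= L) by move=> H; apply: N; exists s, c; split=> //; right.
    apply/andP; split; rewrite ltNge; apply/negP => H; [apply: ns1|apply: ns2]; slra.
  apply: (@caught_pullback delta (L - delta)); [slra|slra|slra|slra|left; slra|right; slra|].
  have -> : iter k sg (P delta) = antipode b.
    by rewrite iter_k_low0 dK /antipode -addrA -circle_ofD.
  have -> : iter k sg (P (L - delta)) = antipode a'.
    by rewrite antipodeK iter_k_high0 opprB addrCA subrr addr0 dK subrr circle_of0 addr0.
  (* [b'] and [a] have the images of [b] and [a'] and share a half circle, so they span a leaf. *)
  apply: (uleaf_lift (@pullback_step _ _ _ _)); last first.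
    by rewrite (sigma_antipode b) (sigma_antipode a'); left; apply: leaf_sigma;
      exact: pullback_base.
  rewrite antipodeK -[X in same_half _ _ X]addr0 -circle_of0 -(shift_period 0) add0r /antipode -addrA -circle_ofD.
  apply: (@same_half_shift _ _ (tau + 2^-1)); [exact: (eps_theta true)|slra|slra].
move=> N.
have Ek i : iter (k * i.+1) sg (P (s + eps c)) = iter (k * i) sg (iter k sg (P (s + eps c))).
  by rewrite mulnS addnC iterD.
rewrite Ek in N.
have := h 0%N erefl; rewrite muln0 /= => -[s' [c' [ps' Es']]].
have hs' : 0 <= s' <= L by case: ps'; slra.
have [Ess _] := shift_eps_inj hs hs' Es'; rewrite -Ess {s' c' Es' hs' Ess} in ps'.
case: ps' => ps.
(* Low end: the arc around the image, in [I'], is contracted towards the low end. *)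
- have K1 : 0 <= 2 ^+ k * s <= L.
    apply/andP; split; first by apply: mulr_ge0; slra.
    by rewrite -[X in _ <= X]dK ler_pM2l //; slra.
  have [||//|[r [t [u [d [[r0 ru ut tL] Eu l]]]]]] := IH (2 ^+ k * s) true K1.
  + by move=> i iN; rewrite -(iter_k_low s c) -Ek; apply: h.
  + by rewrite -(iter_k_low s c).
  + by left.
  have hu : 0 <= u <= L by slra.
  have [Eu' _] := shift_eps_inj K1 hu Eu; rewrite -{u Eu hu}Eu' in ru ut.
  apply: (@caught_pullback (r / 2 ^+ k) (t / 2 ^+ k)).
  + exact: divr_gt0.
  + by rewrite ltr_pdivrMr // mulrC.
  + by rewrite ltr_pdivlMr // mulrC.
  + by apply: (@lt_le_trans _ _ delta); [rewrite ltr_pM2r ?invr_gt0|slra].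
  + by left; rewrite divr_ge0 ?ler_pM2r ?invr_gt0 //; slra.
  + by left; rewrite divr_ge0 ?ler_pM2r ?invr_gt0 //; slra.
  + by rewrite !iter_k_low0 ![2 ^+ k * (_ / _)]mulrC !divfK ?gt_eqF.
(* High end: the arc around the image, in [I], is contracted towards the high end. *)
- have K1 : 0 <= L - 2 ^+ k * (L - s) <= L.
    have : 0 <= 2 ^+ k * (L - s) by apply: mulr_ge0; slra.
    have : 2 ^+ k * (L - s) <= L by rewrite -[X in _ <= X]dK ler_pM2l //; slra.
    slra.
  have [||//|[r [t [u [d [[r0 ru ut tL] Eu l]]]]]] := IH (L - 2 ^+ k * (L - s)) false K1.
  + by move=> i iN; rewrite -(iter_k_high s c) -Ek; apply: h.
  + by rewrite -(iter_k_high s c).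
  + by left.
  have hu : 0 <= u <= L by slra.
  have [Eu' _] := shift_eps_inj K1 hu Eu; rewrite -{u Eu hu}Eu' in ru ut.
  have dd x : 0 < x < L -> 0 < (L - x) / 2 ^+ k < delta.
    move=> hx; apply/andP; split; first by apply: divr_gt0; slra.
    by rewrite ltr_pM2r ?invr_gt0 //; slra.
  have dr : 0 < (L - r) / 2 ^+ k < delta by apply: dd; slra.
  have dt : 0 < (L - t) / 2 ^+ k < delta by apply: dd; slra.
  apply: (@caught_pullback (L - (L - r) / 2 ^+ k) (L - (L - t) / 2 ^+ k)).
  + slra.
  + have : (L - s) < (L - r) / 2 ^+ k by rewrite ltr_pdivlMr // mulrC; slra.
    slra.
  + have : (L - t) / 2 ^+ k < L - s by rewrite ltr_pdivrMr // mulrC; slra.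
    slra.
  + slra.
  + by right; slra.
  + by right; slra.
  + have E x : L - 2 ^+ k * (L - (L - (L - x) / 2 ^+ k)) = x.
      by rewrite subKr mulrC divfK ?gt_eqF // subKr.
    by rewrite !iter_k_high0 !E; have := l false; rewrite /eps !addr0.
Qed.

(** Apply [escape_caught] at the first exit time of [theta]. A leaf from [r < tau] to [s > tau]
    within [I] would cross the diameter, so [theta] is not caught. *)
Lemma exists_good_leaf : good_leaf.
Proof.
have [n N hn] : exists2 n, ~ pieces (iter (k * n) sg theta) &
    forall i, (i < n)%N -> pieces (iter (k * i) sg theta).
  have [n N] := escape.
  have ex : exists n, `[< ~ pieces (iter (k * n) sg theta) >] by exists n; apply/asboolP.
  exists (ex_minn ex); case: ex_minnP => m /asboolP // Nm hm i im.
  apply: contrapT => Ni; have := hm i; rewrite leqNgt im => H.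
  by have := H _; move=> /(_ (asboolT Ni)).
have E : theta = P (tau + eps false) by rewrite /eps addr0.
rewrite E in N hn.
have [|//|] := @escape_caught n tau false _ hn N; first slra.
move=> [r [s [t [c [[r0 rt ts sL]]]]]] Et l.
have ht : 0 <= t <= L by slra.
have htau : 0 <= tau <= L by slra.
have [Ett _] := shift_eps_inj htau ht Et; rewrite -{t Et ht}Ett in rt ts.
have /(uleaf_half leaf_half)[h hE] := l false.
rewrite /eps !addr0 => -[/oarc_half hr /oarc_half hs]; exfalso.
have [Eh|Eh] : h = theta \/ h = P (tau + 2^-1).
  have := sigma_eq hE; rewrite /antipode -addrA -circle_ofD; tauto.
  move: hr; rewrite Eh -(shift_period r) arc_length_shift; slra.
move: hs; rewrite Eh -(shift_period s) arc_length_shift; slra.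
Qed.


(** The branch of [sigma^-k] fixing [b] and [a'] divides the distances to them by [2^k]. *)
Lemma contract_leaf x y : 0 < x < L - tau -> 0 < y < tau ->
  uleaf (P (L - x)) (P (2^-1 + y)) ->
  uleaf (P (L - x / 2 ^+ k)) (P (2^-1 + y / 2 ^+ k)).
Proof.
move=> hx hy l.
have K0 := pow2_gt0 k; have K1 : 1 <= 2 ^+ k :> R by rewrite -natrX ler1n expn_gt0.
have dd z : 0 < z -> z < L -> 0 < z / 2 ^+ k < delta /\ z / 2 ^+ k <= z.
  move=> z0 zL; rewrite divr_gt0 // ltr_pM2r ?invr_gt0 // zL; split=> //.
  by rewrite ler_pdivrMr // ler_peMr // ltW.
have [||dy dy'] := dd y; [slra|slra|].
have [||dx dx'] := dd x; [slra|slra|].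
rewrite -[L - _]addr0 [2^-1 + _]addrC.
apply: (@uleaf_pieces _ _ false true); [by right; slra|by left; slra| |].
  by apply: same_half_cross; slra.
rewrite iter_k_high0 iter_k_low0 subKr ![2 ^+ k * (_ / _)]mulrC !divfK ?gt_eqF //.
by rewrite [y + _]addrC.
Qed.

Lemma leaf_key_base z : oarc a' b z ->
  exists r s, [/\ uleaf r s, oarc r s z, oarc s r b & oarc s r a'].
Proof.
have [u [v [l hu hv]]] := exists_good_leaf.
have K0 := pow2_gt0 k.
(* The good leaf contracted [m] times. *)
have contr m : exists (x y : R), [/\ 0 < x < L - tau, 0 < y < tau,
    uleaf (P (L - x)) (P (2^-1 + y)) & (x <= 1 / 2 ^+ m) /\ (y <= 1 / 2 ^+ m)].
  elim: m => [|m [x [y [hx hy lxy [hxm hym]]]]].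
    exists (L - u), (v - 2^-1); rewrite subKr [2^-1 + _]addrC subrK expr0.
    by split=> //; [slra|slra|split; slra].
  have K2 : 2 <= 2 ^+ k :> R by rewrite -[X in X <= _]expr1 ler_eXn2l // ltr1n.
  have dd (w e : R) : 0 < w < e -> w <= 1 / 2 ^+ m ->
    0 < w / 2 ^+ k < e /\ w / 2 ^+ k <= 1 / 2 ^+ m.+1.
    move=> hw wm; have h2 : w / 2 ^+ k <= w / 2.
      by rewrite ler_pM2l ?lef_pV2 ?posrE //; slra.
    have h0 : 0 < w / 2 ^+ k by apply: divr_gt0 => //; slra.
    split; first slra.
    have -> : 1 / 2 ^+ m.+1 = (1 / 2 ^+ m) / 2 :> R by rewrite exprS invfM; ring.
    slra.
  have [hx1 hx2] := dd _ _ hx hxm; have [hy1 hy2] := dd _ _ hy hym.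
  exists (x / 2 ^+ k), (y / 2 ^+ k); split=> //; exact: contract_leaf.
move=> hz; have c1 := arc_length_itv b z.
have aba' : al b a' = 2^-1 - L by rewrite /antipode arc_length_shift; slra.
have hc : 2^-1 - L < al b z.
  by move: hz => /(oarcE b); rewrite arc_length0 aba' => -[] ?; slra.
(* The leaf ends must be closer to [a'] and [b] than [z] is. *)
have [|m hm] := @pow2_small (Num.min (al b z - (2^-1 - L)) (1 - al b z)).
  by rewrite lt_min !subr_gt0 hc; case/andP: c1.
rewrite lt_min in hm.
have [x [y [hx hy lxy [hxm hym]]]] := contr m.
have al1 : al b (P (2^-1 + y)) = 2^-1 + y - L by rewrite arc_length_shift; slra.
have al2 : al b (P (L - x)) = 1 - x.
  by rewrite -(shift_period (L - x)) arc_length_shift; slra.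
exists (P (2^-1 + y)), (P (L - x)); split; first exact: uleaf_sym.
- by apply/(oarcE b); rewrite al1 al2; constructor 1; slra.
- by apply/(oarcE b); rewrite al1 al2 arc_length0; constructor 2; slra.
- by apply/(oarcE b); rewrite al1 al2 aba'; constructor 2; slra.
Qed.

(** The approximating leaf of the image is lifted to the half circle of [p] and [q]. If [x] is
    outside that half circle, a leaf cutting off [h] is used: its side containing [h] contains the
    whole complement of the half circle. *)
Lemma leaf_key p q x : leaf p q -> oarc q p x ->
  exists r s, [/\ uleaf r s, oarc r s x, oarc s r p & oarc s r q].
Proof.
move=> l; elim: l x => [|{}p {}q [h hc [hp hq]] _ IH] x hx; first exact: leaf_key_base.
have hp' := (oarc_half h p).1 hp; have hq' := (oarc_half h q).1 hq.
suff W w : al h w < 2^-1 -> oarc (sg q) (sg p) (sg w) ->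
    exists r s, [/\ uleaf r s, 0 < al h r < 2^-1, 0 < al h s < 2^-1,
      oarc r s w & oarc s r p /\ oarc s r q].
  case: (pselect (0 < al h x < 2^-1)) => xh.
    have [|| r [s [l _ _ rx [rp rq]]]] := W x; [clra|rewrite (@oarc_sigma _ h) //; clra|].
    by exists r, s.
  have bx := arc_length_itv h x.
  have xh' : al h x = 0 \/ 2^-1 <= al h x.
    case: (ltP (al h x) 2^-1) => H; last by right.
    by left; apply/eqP; rewrite eq_le; apply/andP; split; [rewrite leNgt; apply/negP => H';
      apply: xh; rewrite H H'|clra].
  have pq : al h p < al h q.
    by move: hx => /(oarcE h) []?; case: xh' => xh'; clra.
  have [||r [s [l hr hs rh [rp rq]]]] := W h.
  + by rewrite arc_length0; clra.
  + rewrite (@oarc_sigma _ h) ?arc_length0 //; [|clra..].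
    by apply/(oarcE h); rewrite arc_length0; constructor 2; clra.
  exists r, s; split=> //.
  move: rh => /(oarcE h); rewrite arc_length0 => rh; apply/(oarcE h).
  have sr : al h s < al h r by case: rh => rh; clra.
  by case: xh' => xh'; [constructor 2|constructor 3]; clra.
move=> hw /IH[r1 [s1 [l rw rp rq]]].
have [r1c s1c] := uleaf_crit leaf_crit l; rewrite -hc in r1c s1c.
have [r rE hr] := half_lift r1c; have [s sE hs] := half_lift s1c.
have hr' := (oarc_half h r).1 hr; have hs' := (oarc_half h s).1 hs.
exists r, s; split=> //.
- apply: (uleaf_lift (@pullback_step _ _ _ _)); last by rewrite rE sE.
  by exists h.
- by rewrite -(@oarc_sigma _ h) ?rE ?sE //; clra.
- by split; rewrite -(@oarc_sigma _ h) ?rE ?sE //; clra.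
Qed.

Lemma core_lamination : exists E : T -> T -> Prop,
  [/\ invariant_lamination E, ~ degenerate E & E theta (antipode theta)].
Proof.
apply: (unsep_lamination leaf_half leaf_sigma (@pullback_step _ _ _ _) leaf_crit
  leaf_neq leaf_key leaf_dense (pullback_base _ _ _)).
Qed.

End Core.

(** * Images of the main leaf avoid the interior of D *)

Section Gaps.
Variable R : realType.
Local Notation T := (circle R).
Local Notation pr := (@circle_of R).
Local Notation sg := (@sigma R).
Local Notation al := (@arc_length R).

Lemma circle_dist_sigma (x y : T) : let l := circle_dist x y in
  l <= 2^-1 /\ (circle_dist (sg x) (sg y) = 2 * l \/ circle_dist (sg x) (sg y) = 1 - 2 * l).
Proof.
rewrite /circle_dist !(arc_length_base x y x) !(arc_length_base (sg x) (sg y) (sg x)).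
rewrite !arc_length0 arc_length_sigma.
have := arc_length_itv x y; move: (al x y) => c hc.
have E (u v : R) : (u <= v /\ Num.min u v = u) \/ (v <= u /\ Num.min u v = v).
  by case: (leP u v) => h; [left|right]; split=> //; exact: ltW.
case: (ltP c 2^-1) => h.
  case: (ltP 0 c) => c0; case: (ltP 0 (2 * c)) => c1 /=; try lra.
    case: (E c (0 - c + 1)) => -[e ->]; case: (E (2 * c) (0 - 2 * c + 1)) => -[e' ->]; split;
      try lra; by [left; lra|right; lra].
  case: (E c (0 - c + 0)) => -[e ->]; case: (E (2 * c) (0 - 2 * c + 0)) => -[e' ->]; split;
    try lra; by [left; lra|right; lra].
have c0 : 0 < c by lra.
rewrite c0 /=; case: (ltP 0 (2 * c - 1)) => c1 /=.
  case: (E c (0 - c + 1)) => -[e ->]; case: (E (2 * c - 1) (0 - (2 * c - 1) + 1)) =>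
    -[e' ->]; split; try lra; by [left; lra|right; lra].
case: (E c (0 - c + 1)) => -[e ->]; case: (E (2 * c - 1) (0 - (2 * c - 1) + 0)) => -[e' ->];
  split; try lra; by [left; lra|right; lra].
Qed.

Variables (a : T) (L : R) (k : nat).
Local Notation P s := (a + pr s).
Local Notation b := (P L).
Local Notation a' := (antipode a).
Local Notation delta := (L / 2 ^+ k).
Local Notation hole := (hole a L).
Local Notation piece := (@piece R L k).
Local Notation pieces := (pieces a L k).
Local Notation leg j := (circle_dist (iter j sg b) (iter j sg a')).

(** The closed gap between the two pieces of [I] ([false]) or of [I'] ([true]). *)
Definition inner_gap (c : bool) (z : T) :=
  exists2 d, delta <= d <= L - delta & z = P (d + eps R c).

Hypothesis L0 : 0 < L.
Hypothesis L2 : L < 2^-1.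
Hypothesis k0 : (0 < k)%N.
Hypothesis per_b : iter k sg b = b.
Hypothesis per_a' : iter k sg a' = a'.

Ltac slra := have ? := L0; have ? := L2; clra.

Lemma gap_delta : 0 < delta <= L / 2.
Proof. by apply: (@delta_bounds R L (L / 2) k) => //; slra. Qed.

Lemma circle_dist_shift (r s : R) c : 0 <= s - r <= 2^-1 ->
  circle_dist (P (r + eps R c)) (P (s + eps R c)) = s - r.
Proof.
move=> h; rewrite /circle_dist (arc_length_base (P (r + eps R c)) (P (s + _)) (P (r + _))).
rewrite arc_length0 arc_length_shift; last by clra.
have -> : s + eps R c - (r + eps R c) = s - r by ring.
case: (ltP 0 (s - r)) => h' /=; apply/min_idPl; clra.
Qed.

Lemma circle_distC (x y : T) : circle_dist x y = circle_dist y x.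
Proof. by rewrite /circle_dist minC. Qed.

Lemma gap_dist (m M : R) c z w : M - m <= 2^-1 ->
  (exists2 d, m <= d <= M & z = P (d + eps R c)) ->
  (exists2 d, m <= d <= M & w = P (d + eps R c)) -> circle_dist z w <= M - m.
Proof.
move=> h [d hd ->] [e he ->]; case: (leP d e) => de.
  by rewrite circle_dist_shift; clra.
by rewrite circle_distC circle_dist_shift; clra.
Qed.

(** The complement of [H] has four components, the main holes and the inner gaps; an arc missing [H]
    lies in one of them. *)
Lemma arc_in_gap z w : z <> w -> (forall u, pieces u -> ~ oarc z w u) ->
  exists c, (hole c z /\ hole c w) \/ (inner_gap c z /\ inner_gap c w).
Proof.
move=> zw N; have [d0 dL] := andP gap_delta.
have hz := arc_length_itv a z; have hw := arc_length_itv a w.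
have zE := esym (arc_lengthK a z); have wE := esym (arc_lengthK a w).
have nZW : al a z != al a w by apply/eqP => /arc_length_inj.
move: hz hw zE wE nZW; move: (al a z) (al a w) => Z W hz hw zE wE nZW.
have NP u : 0 <= u < 1 -> pieces (P u) ->
    ~ [\/ Z < u < W, u < W < Z | W < Z < u].
  move=> hu pu H; apply: (N _ pu); apply/(oarcE a).
  by rewrite zE wE !(@arc_lengthP _ a (P _) _ _ erefl).
have pl u : 0 <= u <= delta -> pieces (P u).
  by move=> h; exists u, false; split; [left|rewrite /eps addr0].
have ph u : L - delta <= u <= L -> pieces (P u).
  by move=> h; exists u, false; split; [right|rewrite /eps addr0].
have pl' u : 0 <= u - 2^-1 <= delta -> pieces (P u).
  by move=> h; exists (u - 2^-1), true; split; [left|rewrite /eps subrK].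
have ph' u : L - delta <= u - 2^-1 <= L -> pieces (P u).
  by move=> h; exists (u - 2^-1), true; split; [right|rewrite /eps subrK].
have NL u : 0 <= u <= delta -> ~ [\/ Z < u < W, u < W < Z | W < Z < u].
  by move=> h; apply: NP; [slra|exact: pl].
have NH u : L - delta <= u <= L -> ~ [\/ Z < u < W, u < W < Z | W < Z < u].
  by move=> h; apply: NP; [slra|exact: ph].
have NL' u : 0 <= u - 2^-1 <= delta -> ~ [\/ Z < u < W, u < W < Z | W < Z < u].
  by move=> h; apply: NP; [slra|exact: pl'].
have NH' u : L - delta <= u - 2^-1 <= L -> ~ [\/ Z < u < W, u < W < Z | W < Z < u].
  by move=> h; apply: NP; [slra|exact: ph'].
have in_hole c (s : R) x : L <= s - eps R c <= 2^-1 -> x = P s -> hole c x.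
  by move=> h ->; exists (s - eps R c); rewrite ?subrK.
have in_gap c (s : R) x : delta <= s - eps R c <= L - delta -> x = P s -> inner_gap c x.
  by move=> h ->; exists (s - eps R c); rewrite ?subrK.
(* If [W < Z], the arc reaches the origin [a], a point of [H], so it ends there. *)
case: (ltgtP Z W) nZW => // ZW _; last first.
  have W0 : W = 0.
    case: (ltP 0 W) => W0; last by slra.
    by exfalso; apply: (NL 0); [slra|constructor 2; slra].
  have hZ : 2^-1 + L <= Z.
    case: (leP (2^-1 + L) Z) => // hZ; exfalso.
    by apply: (NH' (2^-1 + L)); [slra|constructor 3; slra].
  exists true; left; split.
    by apply: (in_hole _ Z) => //; rewrite /eps; slra.
  apply: (in_hole _ 1); first by rewrite /eps; slra.
  by rewrite wE W0 -(shift_period a 0) add0r.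
(* The midpoint of the arc determines the component. *)
have ZWM : Z < (Z + W) / 2 < W by slra.
have mid : [\/ delta < (Z + W) / 2 < L - delta, L < (Z + W) / 2 < 2^-1,
    delta + 2^-1 < (Z + W) / 2 < L - delta + 2^-1 | L + 2^-1 < (Z + W) / 2].
  case: (ltP delta ((Z + W) / 2)) => h1; last by exfalso; apply: (NL ((Z + W) / 2));
    [slra|constructor 1].
  case: (ltP ((Z + W) / 2) (L - delta)) => h2; first by constructor 1.
  case: (ltP L ((Z + W) / 2)) => h3; last by exfalso; apply: (NH ((Z + W) / 2));
    [slra|constructor 1].
  case: (ltP ((Z + W) / 2) 2^-1) => h4; first by constructor 2.
  case: (ltP (delta + 2^-1) ((Z + W) / 2)) => h5; last by exfalso;
    apply: (NL' ((Z + W) / 2)); [slra|constructor 1].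
  case: (ltP ((Z + W) / 2) (L - delta + 2^-1)) => h6; first by constructor 3.
  case: (ltP (L + 2^-1) ((Z + W) / 2)) => h7; first by constructor 4.
  by exfalso; apply: (NH' ((Z + W) / 2)); [slra|constructor 1].
have cut x : 0 <= x -> (0 <= x <= delta \/ L - delta <= x <= L) \/
   (0 <= x - 2^-1 <= delta \/ L - delta <= x - 2^-1 <= L) -> Z < x < W -> False.
  move=> x0 + h; case=> -[] H; [apply: (NL x)|apply: (NH x)|apply: (NL' x)|apply: (NH' x)] =>
    //; by constructor 1.
case: mid => M.
- exists false; right.
  have Z1 : delta <= Z by case: (leP delta Z) => // h; exfalso; apply: (cut delta);
    [slra|left; left; slra|slra].
  have W1 : W <= L - delta by case: (leP W (L - delta)) => // h; exfalso;
    apply: (cut (L - delta)); [slra|left; right; slra|slra].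
  by split; [apply: (in_gap _ Z)|apply: (in_gap _ W)] => //; rewrite /eps; slra.
- exists false; left.
  have Z1 : L <= Z by case: (leP L Z) => // h; exfalso; apply: (cut L); [slra|left; right;
    slra|slra].
  have W1 : W <= 2^-1 by case: (leP W 2^-1) => // h; exfalso; apply: (cut 2^-1); [slra|right;
    left; slra|slra].
  by split; [apply: (in_hole _ Z)|apply: (in_hole _ W)] => //; rewrite /eps; slra.
- exists true; right.
  have Z1 : delta + 2^-1 <= Z by case: (leP (delta + 2^-1) Z) => // h; exfalso;
    apply: (cut (delta + 2^-1)); [slra|right; left; slra|slra].
  have W1 : W <= L - delta + 2^-1 by case: (leP W (L - delta + 2^-1)) => // h; exfalso;
    apply: (cut (L - delta + 2^-1)); [slra|right; right; slra|slra].
  by split; [apply: (in_gap _ Z)|apply: (in_gap _ W)] => //; rewrite /eps; slra.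
- exists true; left.
  have Z1 : L + 2^-1 <= Z by case: (leP (L + 2^-1) Z) => // h; exfalso;
    apply: (cut (L + 2^-1)); [slra|right; right; slra|slra].
  by split; [apply: (in_hole _ Z)|apply: (in_hole _ W)] => //; rewrite /eps; slra.
Qed.

(** Supplies the second point on one side of the chord that [noncrossing] asks for. *)
Lemma pieces_not_isolated x y v : oarc x y v -> pieces v ->
  exists v', [/\ oarc x y v', pieces v' & v <> v'].
Proof.
move=> xv [s [c [ps vE]]]; have [d0 dL] := andP gap_delta.
have /nbhs_circle[e e0 he] : nbhs v (oarc x y).
  by apply: open_nbhs_nbhs; split=> //; exact: oarc_open.
pose d := Num.min (e / 2) (delta / 4).
have d0' : 0 < d by rewrite lt_min; slra.
have [d1 d2] : d <= e / 2 /\ d <= delta / 4 by rewrite /d !ge_min !lexx ?orbT.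
have [r [hr pr']] : exists r, (r = d \/ r = - d) /\ piece (s + r).
  case: ps => hs.
    case: (leP s (delta / 2)) => h; [exists d|exists (- d)]; split; try by [left|right].
      by left; slra.
    by left; slra.
  case: (leP s (L - delta / 2)) => h; [exists d|exists (- d)]; split; try by [left|right].
    by right; slra.
  by right; slra.
exists (v + pr r); split.
- by apply: he; case: hr => ->; rewrite ?normrN ger0_norm; slra.
- by exists (s + r), c; split=> //; rewrite vE -addrA -circle_ofD; congr (a + pr _); ring.
- rewrite -[LHS]addr0 => /addrI; rewrite -circle_of0 => /circle_of_eq[n En].
  have : - r = 0.
    by apply: (@int_small _ n) => //; [case: hr => ->; slra|slra].
  by case: hr => ->; slra.
Qed.

Hypothesis noncrossing : forall j z w u v v', (0 < j < k)%N ->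
  (z = iter j sg b /\ w = iter j sg a') \/ (w = iter j sg b /\ z = iter j sg a') ->
  pieces u -> pieces v -> pieces v' -> v <> v' ->
  ~ [/\ oarc z w u, oarc w z v & oarc w z v'].

Lemma gap_b_neq_a' : b <> a'.
Proof.
move=> E; have : L = 2^-1; last by slra.
by apply: (shift_inj _ _ E); slra.
Qed.

(** By [noncrossing], [H] cannot have points on both sides of an image of the main leaf. *)
Lemma gap_orbit j : (0 < j < k)%N ->
  exists c, (hole c (iter j sg b) /\ hole c (iter j sg a')) \/
            (inner_gap c (iter j sg b) /\ inner_gap c (iter j sg a')).
Proof.
move=> jk; have jk' : (j <= k)%N by lia.
have zw : iter j sg b <> iter j sg a'.
  move=> E; apply: gap_b_neq_a'.
  by rewrite -per_b -per_a' -(subnK jk') !iterD E.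
case: (pselect (exists2 u, pieces u & oarc (iter j sg b) (iter j sg a') u)) => [[u pu hu]|N].
  case: (pselect (exists2 v, pieces v & oarc (iter j sg a') (iter j sg b) v)) => [[v pv hv]|N].
    have [v' [hv' pv' vv']] := pieces_not_isolated hv pv.
    by exfalso; apply: (@noncrossing j _ _ u v v' jk); [left|..].
  have [|c H] := @arc_in_gap _ _ (nesym zw); first by move=> v pv hv; apply: N; exists v.
  by exists c; tauto.
by apply: arc_in_gap => // u pu hu; apply: N; exists u.
Qed.

(** * Lengths along the orbit of the main leaf *)

Lemma leg0 : leg 0 = 2^-1 - L.
Proof. by have := @circle_dist_shift L 2^-1 false; rewrite /eps !addr0; apply; slra. Qed.

Lemma leg_bound j : (j <= k)%N -> leg j <= 2^-1 - L \/ leg j < L.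
Proof.
have [d0 dL] := andP gap_delta.
move=> jk; case: (posnP j) => [->|j0]; first by left; rewrite leg0.
move: jk; rewrite leq_eqVlt => /orP[/eqP ->|jk]; first by left; rewrite per_b per_a' leg0.
have [|c [[h1 h2]|[h1 h2]]] := @gap_orbit j; first by rewrite j0.
  by left; apply: (gap_dist _ h1 h2); slra.
by right; apply: (@le_lt_trans _ _ (L - delta - delta)); [apply: (gap_dist _ h1 h2); slra|slra].
Qed.

Lemma leg_step j : leg j <= 2^-1 /\ (leg j.+1 = 2 * leg j \/ leg j.+1 = 1 - 2 * leg j).
Proof. by rewrite !iterS; exact: circle_dist_sigma. Qed.

Lemma half_pow_le (x : R) i : 0 <= x -> x / 2 ^+ i <= x.
Proof.
move=> x0; rewrite ler_pdivrMr ?exprn_gt0 // ler_peMr // -natrX ler1n expn_gt0 //.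
Qed.

Lemma half_powS (x : R) i : x / 2 ^+ i.+1 = (x / 2 ^+ i) / 2.
Proof. by rewrite exprS invfM; ring. Qed.

(* Otherwise the main leaf would be short, and its length, which doubles at each step,
   cannot return to its original value. *)
Lemma arc_short : L <= 4^-1.
Proof.
case: (leP L 4^-1) => // L4; exfalso.
(* Backwards each length [l] is halved, since the other preimage length [(1 - l) / 2] exceeds both
   bounds of [leg_bound]. *)
have S i : (i <= k)%N -> leg (k - i) = (2^-1 - L) / 2 ^+ i.
  elim: i => [_|i IH ik]; first by rewrite subn0 expr0 divr1 per_b per_a' leg0.
  have [l2] := leg_step (k - i.+1).
  have Ei : ((k - i.+1).+1 = k - i)%N by lia.
  have hi := @half_pow_le (2^-1 - L) i; rewrite Ei IH; last lia.
  have hb := @leg_bound (k - i.+1) (leq_subr _ _).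
  rewrite half_powS; have {hi} hi := hi _.
  have hi' : (2^-1 - L) / 2 ^+ i <= 2^-1 - L by apply: hi; slra.
  by case=> h; case: hb => hb; slra.
have := S k (leqnn k); rewrite subnn leg0 -(prednK k0) half_powS => h.
have := @half_pow_le (2^-1 - L) k.-1; slra.
Qed.

(* A leaf in an inner gap is short; going backwards its length is halved at each
   step, as the other preimage length exceeds that of the main leaf. *)
Lemma gap_orbit_hole j : (0 < j < k)%N ->
  exists c, hole c (iter j sg b) /\ hole c (iter j sg a').
Proof.
move=> jk; have L4 := arc_short; have [d0 dL] := andP gap_delta.
have [c [h|[h1 h2]]] := gap_orbit jk; first by exists c.
exfalso; have lj : leg j < L.
  by apply: (@le_lt_trans _ _ (L - delta - delta)); [apply: (gap_dist _ h1 h2); slra|slra].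
have S i : (i <= j)%N -> leg (j - i) < L / 2 ^+ i.
  elim: i => [_|i IH ij]; first by rewrite subn0 expr0 divr1.
  have [l2] := leg_step (j - i.+1).
  have Ei : ((j - i.+1).+1 = j - i)%N by lia.
  have hi : L / 2 ^+ i <= L by apply: half_pow_le; slra.
  have := IH (ltnW ij); rewrite Ei half_powS => H.
  have hb : leg (j - i.+1) <= 2^-1 - L \/ leg (j - i.+1) < L by apply: leg_bound; lia.
  by case=> h; case: hb => hb; slra.
have := S j (leqnn j); rewrite subnn leg0 => h.
have : L / 2 ^+ j <= L by apply: half_pow_le; slra.
have jE : j = j.-1.+1 by lia.
have := @half_pow_le L j.-1; rewrite jE half_powS in h *; slra.
Qed.

End Gaps.

(** * Horseshoes *)

Section Horseshoe.
Variable R : realType.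
Local Notation T := (circle R).
Local Notation pr := (@circle_of R).
Local Notation sg := (@sigma R).
Local Notation al := (@arc_length R).
Local Notation eps := (eps R).

(** * The set [H] in coordinates *)

Section Pieces.
Variables (a : T) (L : R) (k : nat).
Local Notation P s := (a + pr s).
Local Notation b := (P L).
Local Notation a' := (antipode a).
Local Notation b' := (antipode b).
Local Notation delta := (L / 2 ^+ k).
Local Notation pieces := (pieces a L k).

Hypothesis L0 : 0 < L.
Hypothesis L2 : L < 2^-1.
Hypothesis k0 : (0 < k)%N.

Ltac slra := have ? := L0; have ? := L2; clra.

Let delta_bd : 0 < delta <= L / 2 := gap_delta L0 L2 k0.

Lemma shift_low : P (0 + eps false) = a.
Proof. by rewrite addr0 circle_of0 addr0. Qed.

Lemma shift_high : P (L + eps false) = b.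
Proof. by rewrite addr0. Qed.

Lemma shift_low' : P (0 + eps true) = a'.
Proof. by rewrite add0r. Qed.

Lemma shift_high' : P (L + eps true) = b'.
Proof. by rewrite circle_ofD addrA. Qed.

Lemma carc_shift (r s t : R) c : 0 <= t - r < 1 -> 0 <= s - r < 1 ->
  carc (P (r + eps c)) (P (s + eps c)) (P (t + eps c)) = (t <= s).
Proof.
move=> ht hs; rewrite /carc /= !arc_length_shift.
- by apply/propext; split; clra.
- by clra.
- by clra.
Qed.

Lemma carc_shiftP (r s : R) c q : 0 <= s - r < 1 ->
  carc (P (r + eps c)) (P (s + eps c)) q -> exists2 t, r <= t <= s & q = P (t + eps c).
Proof.
move=> hs; rewrite /carc /= [X in _ <= X]arc_length_shift; last by clra.
have := arc_length_itv (P (r + eps c)) q => h1 h2.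
exists (r + al (P (r + eps c)) q); first by clra.
rewrite -{1}(arc_lengthK (P (r + eps c)) q) -addrA -circle_ofD.
by congr (a + pr _); ring.
Qed.

Lemma piece_itv s : piece L k s -> 0 <= s <= L.
Proof. by have := delta_bd => ?; case; slra. Qed.

Lemma pieces_domain z : pieces z -> hs_domain a b z.
Proof.
case=> s [c [/piece_itv hs ->]]; rewrite /hs_domain.
by case: c; [right; rewrite -shift_low' -shift_high'|left;
  rewrite -shift_high -{1}shift_low]; rewrite carc_shift; slra.
Qed.

Lemma endpoint_pieces e : [\/ e = a, e = b, e = a' | e = b'] -> pieces e.
Proof.
have ? := delta_bd.
case=> ->.
- by exists 0, false; rewrite shift_low; split=> //; left; slra.
- by exists L, false; rewrite shift_high; split=> //; right; slra.
- by exists 0, true; rewrite shift_low'; split=> //; left; slra.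
- by exists L, true; rewrite shift_high'; split=> //; right; slra.
Qed.

(** [theta] and [theta'] play symmetric parts, so the one inside [I] is taken as critical point. *)
Lemma lamination_of_holes theta : has_period k b -> has_period k a' ->
  (forall j, (0 < j < k)%N ->
     exists c, hole a L c (iter j sg b) /\ hole a L c (iter j sg a')) ->
  is_periodic (sg theta) ->
  oarc a b theta \/ oarc a b (antipode theta) ->
  (exists i, ~ pieces (iter (k * i) sg theta)) ->
  (exists i, ~ pieces (iter (k * i) sg (antipode theta))) ->
  exists E : T -> T -> Prop,
    [/\ invariant_lamination E, ~ degenerate E & E theta (antipode theta)].
Proof.
move=> [_ pb nb] [_ pa na] holes per.
have W t : sg t = sg theta -> oarc a b t -> (exists i, ~ pieces (iter (k * i) sg t)) ->
    exists E : T -> T -> Prop,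
      [/\ invariant_lamination E, ~ degenerate E & E t (antipode t)].
  move=> tE; have -> : oarc a b t = (0 < al a t < L) :> Prop.
    by rewrite /oarc /= (@arc_lengthP _ a b L) //; slra.
  move: tE; have := arc_lengthK a t; move: (al a t) => tau <- tE ht esc.
  by apply: (core_lamination ht L2 k0 pb pa nb na holes _ esc); rewrite tE.
case=> th esc esc'; first by exact: (W theta).
have [|E [h1 h2 h3]] := W _ _ th esc'; first exact: sigma_antipode.
exists E; split=> //; rewrite antipodeK in h3.
by case: h1 => -[[_ s _] _ _ _] _; exact: s.
Qed.

Hypothesis per_b : iter k sg b = b.
Hypothesis per_a' : iter k sg a' = a'.

(** Shows that a point whose orbit under [sigma^k] leaves [H] is no endpoint of [D]. *)
Lemma endpoint_orbit i e : [\/ e = a, e = b, e = a' | e = b'] ->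
  pieces (iter (k * i) sg e).
Proof.
have fix_iter x : iter k sg x = x -> iter (k * i) sg x = x.
  by move=> xE; elim: i => [|i IH]; rewrite ?muln0 // mulnS iterD IH.
have fb := fix_iter _ per_b; have fa := fix_iter _ per_a'.
case: (posnP i) => [->|i0]; first by rewrite muln0; exact: endpoint_pieces.
have ki : (0 < k * i)%N by rewrite muln_gt0 k0.
case=> ->; apply: endpoint_pieces.
- by constructor 3; rewrite -{1}fa iter_sigma_antipode.
- by constructor 2.
- by constructor 3.
- by constructor 2; rewrite iter_sigma_antipode.
Qed.

(** Stretched by [2^k] from [a'], the arc first reaches [b'] after length [delta]. *)
Lemma closest_low c : closest_preimage k b' (carc (P (0 + eps c)) (P (L + eps c)))
  (P (0 + eps c)) (P (delta + eps c)).
Proof.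
have db := delta_bd; have K0 : 0 < 2 ^+ k :> R by exact: exprn_gt0.
have dK : 2 ^+ k * delta = L := deltaK L k.
split.
- by rewrite carc_shift; slra.
- by rewrite (iter_k_low k0 per_a') dK shift_high'.
move=> q /carc_shiftP[|s hs ->]; first by slra.
rewrite (iter_k_low k0 per_a') -shift_high' => /shift_eq[n En].
rewrite !circle_dist_shift; [|slra|slra].
have n0 : (-1)%:~R < n%:~R :> R.
  have : 0 <= 2 ^+ k * s by apply: mulr_ge0; slra.
  by rewrite intrN; slra.
have n1 : 0 <= n%:~R :> R by rewrite ler0z; rewrite ltr_int in n0; lia.
have : L / 2 ^+ k <= s by rewrite ler_pdivrMr // mulrC; slra.
slra.
Qed.

Lemma closest_high c : closest_preimage k a (carc (P (0 + eps c)) (P (L + eps c)))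
  (P (L + eps c)) (P (L - delta + eps c)).
Proof.
have db := delta_bd; have K0 : 0 < 2 ^+ k :> R by exact: exprn_gt0.
have dK : 2 ^+ k * delta = L := deltaK L k.
split.
- by rewrite carc_shift; slra.
- by rewrite (iter_k_high k0 per_b) subKr dK subrr shift_low.
move=> q /carc_shiftP[|s hs ->]; first by slra.
rewrite (iter_k_high k0 per_b) -[RHS]shift_low => /shift_eq[n En].
rewrite ![circle_dist (P (L + _)) _]circle_distC !circle_dist_shift; [|slra|slra].
have h0 : 0 <= 2 ^+ k * (L - s) by apply: mulr_ge0; slra.
have n0 : n%:~R < 1%:~R :> R by rewrite /eps in En; slra.
have n1 : n%:~R <= 0 :> R by rewrite lerz0; rewrite ltr_int in n0; lia.
have : L / 2 ^+ k <= L - s.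
  by rewrite ler_pdivrMr // mulrC; rewrite /eps in En; slra.
slra.
Qed.

Lemma endpoints_neq : [/\ a' <> a, a' <> b & b <> a].
Proof.
have n r s : 0 <= r < 1 -> 0 <= s < 1 -> P r = P s -> r = s by exact: shift_inj.
split=> E.
- have := n 2^-1 0; rewrite circle_of0 addr0 => H.
  by have : 2^-1 = 0 :> R; [apply: H => //; slra|slra].
- by have : 2^-1 = L; [apply: n => //; slra|slra].
- have := n L 0; rewrite circle_of0 addr0 => H.
  by have : L = 0 :> R; [apply: H => //; slra|slra].
Qed.

(** [sigma^k] sends [a] and [a'] to [a'], with target [b'], and [b] and [b'] to [b], with target
    [a]. *)
Lemma pieces_sub z : pieces z -> hs_pieces a b k z.
Proof.
have db := delta_bd; have [n1 n2 n3] := endpoints_neq.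
have oa : other_end a b a' = b' by rewrite /other_end; do 3 case: eqP => //.
have ob : other_end a b b = a by rewrite /other_end; do 2 case: eqP => //.
case=> s [c [ps ->]]; rewrite /hs_pieces /=.
have Ea : iter k sg a = a' by rewrite -(iter_sigma_antipode a k0).
have Eb : iter k sg b' = b by rewrite (iter_sigma_antipode b k0).
rewrite Ea Eb per_b per_a' oa ob.
case: ps => hs; case: c.
- left; right; exists (P (delta + eps true)).
    by have := closest_low true; rewrite shift_low' shift_high'.
  by rewrite -shift_low' carc_shift; slra.
- left; left; left; exists (P (delta + eps false)).
    by have := closest_low false; rewrite shift_low shift_high.
  by rewrite -{1}shift_low carc_shift; slra.
- right; exists (P (L - delta + eps true)).
    by have := closest_high true; rewrite shift_low' shift_high'.
  by rewrite -shift_high' carc_shift; slra.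
- left; left; right; exists (P (L - delta + eps false)).
    by have := closest_high false; rewrite shift_low shift_high.
  by rewrite -{1}shift_high carc_shift; slra.
Qed.

(** The same with [I] and [I'] exchanged, for horseshoes whose periodic endpoints are [b'] and
    [a]. *)
Lemma pieces_sub_antipode z : pieces z -> hs_pieces a' b' k z.
Proof.
have db := delta_bd; have [n1 n2 n3] := endpoints_neq.
have n4 : b <> b'.
  move=> E; have := arc_length_antipode_r b; rewrite -E arc_length0; slra.
have oa : other_end a' b' a' = b' by rewrite /other_end eqxx.
have ob : other_end a' b' b = a.
  rewrite /other_end !antipodeK; case: (b =P a') => [E|_]; first by case: n2.
  by case: (b =P b') => // _; case: (b =P a).
case=> s [c [ps ->]]; rewrite /hs_pieces /= !antipodeK.
have Ea : iter k sg a = a' by rewrite -(iter_sigma_antipode a k0).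
have Eb : iter k sg b' = b by rewrite (iter_sigma_antipode b k0).
rewrite Ea Eb per_b per_a' oa ob.
case: ps => hs; case: c.
- left; left; left; exists (P (delta + eps true)).
    by have := closest_low true; rewrite shift_low' shift_high'.
  by rewrite -shift_low' carc_shift; slra.
- left; right; exists (P (delta + eps false)).
    by have := closest_low false; rewrite shift_low shift_high.
  by rewrite -{1}shift_low carc_shift; slra.
- left; left; right; exists (P (L - delta + eps true)).
    by have := closest_high true; rewrite shift_low' shift_high'.
  by rewrite -shift_high' carc_shift; slra.
- right; exists (P (L - delta + eps false)).
    by have := closest_high false; rewrite shift_low shift_high.
  by rewrite -{1}shift_high carc_shift; slra.
Qed.

End Pieces.

(** * Traveling horseshoes *)

Lemma interior_boundary (C D : set (R^o * R^o)) X :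
  C `&` D `<=` boundary C `&` boundary D -> C^° X -> ~ D X.
Proof.
move=> CD CX DX; have [|[_ h] _] := CD X; last exact: h.
by split=> //; exact: interior_subset.
Qed.


(* [H] is a parameter so that the lemma applies with [(a', b')] in the place of
   [(a, b)] when [b'] and [a] are the periodic endpoints. *)
Lemma traveling_lamination (a b theta : T) k (H : set T) :
  carc a b `&` carc (antipode a) (antipode b) = set0 -> a <> b ->
  has_period k b -> has_period k (antipode a) ->
  (forall (L : R), 0 < L -> L < 2^-1 -> b = a + pr L -> pieces a L k `<=` H) ->
  (forall j, (0 < j < k)%N -> let C := hull H in let D := hull (iter j sg @` H) in
     C `&` D `<=` boundary C `&` boundary D) ->
  is_periodic (sg theta) ->
  ~ main_holes a b theta ->
  (exists i, ~ H (iter (k * i) sg theta)) ->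
  (exists i, ~ H (iter (k * i) sg (antipode theta))) ->
  exists E : T -> T -> Prop,
    [/\ invariant_lamination E, ~ degenerate E & E theta (antipode theta)].
Proof.
move=> disj ab pb pa pH trav per nh esc esc'.
have k0 : (0 < k)%N by case: pb.
have hL := arc_length_itv a b.
have L0 : 0 < al a b.
  rewrite lt_neqAle andbC; case/andP: (hL) => -> _ /=; apply/eqP => E; apply: ab.
  by apply: (@arc_length_inj _ a); rewrite -E arc_length0.
(* A longer arc [I] would contain the endpoint [a'] of [I']. *)
have L2 : al a b < 2^-1.
  rewrite ltNge; apply/negP => h.
  have : (carc a b `&` carc (antipode a) (antipode b)) (antipode a).
    by split; rewrite /carc /= ?arc_length0 ?arc_length_antipode_r //;
      case/andP: (arc_length_itv (antipode a) (antipode b)).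
  by rewrite disj.
have per_b : iter k sg b = b by case: pb.
have per_a' : iter k sg (antipode a) = antipode a by case: pa.
have bE := arc_lengthK a b; move: hL L0 L2 bE; move: (al a b) => L hL L0 L2 bE.
have {}pH := pH L L0 L2 (esym bE).
rewrite -bE {b bE} in disj ab pb per_b nh trav.
have escP t : (exists i, ~ H (iter (k * i) sg t)) ->
  exists i, ~ pieces a L k (iter (k * i) sg t).
  by case=> i N; exists i => h; apply: N; exact: pH.
apply: (lamination_of_holes L0 L2 k0 pb pa) => //; [|..|exact: escP|exact: escP].
  move=> j jk; apply: (gap_orbit_hole L0 L2 k0 per_b per_a') =>
    // {}j z w u v v' {}jk E pu pv pv' vv' [zu wv wv'].
  have zw : (iter j sg @` H) z /\ (iter j sg @` H) w.
    have hb : H (a + pr L) by apply/pH/endpoint_pieces => //; constructor 2.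
    have ha : H (antipode a) by apply/pH/endpoint_pieces => //; constructor 3.
    by case: E => -[-> ->]; split; by [exists (a + pr L)|exists (antipode a)].
  (* A crossing puts an interior point of the hull of [H] into the hull of its image. *)
  have [X X1 X2] := chord_crossing (pH _ pu) (pH _ pv) (pH _ pv') vv' zw.1 zw.2 zu wv wv'.
  exact: (interior_boundary (trav j jk) X1).
(* Endpoints of [D] never leave [H], so [theta] is none of them and lies strictly inside [I] or
   [I']. *)
have N e : [\/ e = a, e = a + pr L, e = antipode a | e = antipode (a + pr L)] ->
    ~ exists i, ~ H (iter (k * i) sg e).
  by move=> eE [i]; apply; apply: pH; exact: endpoint_orbit.
have Nt e : [\/ e = a, e = a + pr L, e = antipode a | e = antipode (a + pr L)] -> theta <> e.
  by move=> eE E; apply: (N e eE); rewrite -E.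
have alP r : 0 <= r < 1 -> al a (a + pr r) = r by move=> hr; exact: arc_lengthP.
have aL : al a (a + pr L) = L by apply: alP; clra.
have aL' : al a (antipode (a + pr L)) = L + 2^-1.
  by rewrite /antipode -addrA -circle_ofD alP //; clra.
have a2 := arc_length_antipode_r a.
have tE e : al a theta = al a e -> theta = e by exact: arc_length_inj.
have ht := arc_length_itv a theta.
have {}nh : (L < al a theta < 2^-1 -> False) /\ (L + 2^-1 < al a theta -> False).
  split=> h; apply: nh; [right|left]; apply/(oarcE a); rewrite ?aL ?aL' ?a2 ?arc_length0.
    by constructor 1; clra.
  by constructor 3; clra.
have n1 : al a theta != 0.
  by apply/eqP => E; apply: (Nt a); [constructor 1|apply: tE; rewrite E arc_length0].
have n2 : al a theta != L.
  by apply/eqP => E; apply: (Nt (a + pr L)); [constructor 2|apply: tE; rewrite E aL].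
have n3 : al a theta != 2^-1.
  by apply/eqP => E; apply: (Nt (antipode a)); [constructor 3|apply: tE; rewrite E a2].
have n4 : al a theta != L + 2^-1.
  by apply/eqP => E; apply: (Nt (antipode (a + pr L))); [constructor 4|apply: tE;
    rewrite E aL'].
rewrite /oarc /= aL.
rewrite arc_length_to_antipode.
have [nh1 nh2] := nh; have gt0n (x y : R) : x != y -> x <= y -> x < y.
  by move=> h1 h2; rewrite lt_neqAle h1.
case: (ltP (al a theta) 2^-1) => h; [left|right].
  have h1 : al a theta <= L by rewrite leNgt; apply/negP => h'; apply: nh1; rewrite h'.
  have := gt0n _ _ n2 h1; have : 0 < al a theta by apply: gt0n; [rewrite eq_sym|clra].
  by move=> -> ->.
have h1 : al a theta <= L + 2^-1 by rewrite leNgt; apply/negP => h'; apply: nh2.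
have := gt0n _ _ n4 h1; have : 2^-1 < al a theta by apply: gt0n => //; rewrite eq_sym.
clra.
Qed.

Lemma traveling_horseshoe_lamination (a b : T) k theta :
  traveling_horseshoe a b k -> is_periodic (sg theta) ->
  ~ (horseshoe a b k `|` main_holes a b) theta ->
  ~ (horseshoe a b k `|` main_holes a b) (antipode theta) ->
  exists E : T -> T -> Prop,
    [/\ invariant_lamination E, ~ degenerate E & E theta (antipode theta)].
Proof.
move=> [[disj _ _ gen] trav] per hth hth'.
(* If [a = b], both [a] and [a'] are fixed by [sigma^k], which takes the same value at them. *)
have ab : a <> b.
  move=> E; rewrite -E in gen.
  have {gen} [pa pa'] : has_period k a /\ has_period k (antipode a) by tauto.
  have [k0 Ea _] := pa; have [_ Ea' _] := pa'.
  have aa : a = antipode a by rewrite -[LHS]Ea -[RHS]Ea' iter_sigma_antipode.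
  by have := arc_length_antipode_r a; rewrite -aa arc_length0; clra.
have esc t : ~ (horseshoe a b k `|` main_holes a b) t ->
    exists i, ~ hs_pieces a b k (iter (k * i) sg t).
  by move=> h; apply/existsNP => H; apply: h; left.
have nh : ~ main_holes a b theta by move=> h; apply: hth; right.
case: gen => -[p1 p2].
  apply: (traveling_lamination disj ab p1 p2 _ trav per nh (esc _ hth) (esc _ hth')).
  move=> L L0 L2 bE z; rewrite bE.
  have [k0 pb _] := p1; have [_ pa _] := p2; rewrite bE in pb.
  exact: (pieces_sub L0 L2 k0 pb pa).
apply: (@traveling_lamination (antipode a) (antipode b) theta k (hs_pieces a b k)) => //.
- by rewrite !antipodeK setIC.
- by move=> E; apply: ab; rewrite -(antipodeK a) E antipodeK.
- by rewrite antipodeK.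
- move=> L L0 L2 bE z pz.
  have [k0 pb _] := p1; have [_ pa _] := p2; rewrite bE in pb.
  rewrite -(antipodeK a) in pa.
  have := pieces_sub_antipode L0 L2 k0 pb pa pz.
  by rewrite -bE !antipodeK.
- by rewrite /main_holes !antipodeK setUC.
- exact: esc.
- exact: esc.
Qed.

(** * Canonic horseshoes *)

Lemma arc_connected (e : T) (r s : R) : connected ((fun t => e + pr t) @` `[r, s]).
Proof.
apply: connected_continuous_connected; first exact: segment_connected.
apply: continuous_subspaceT => t.
rewrite (_ : (fun t => e + pr t) = (fun t => pr t : T) \o (fun t => coord e + t)); last first.
  by apply/funext => u /=; rewrite circle_ofD coordK.
apply: continuous_comp; last exact: pi_continuous.
by apply: cvgD; [exact: cvg_cst|exact: cvg_id].
Qed.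

(* An endpoint outside of [A] could be added to the component. *)
Lemma component_endpoints (A : set T) (x y : T) : is_component (oarc x y) (~` A) ->
  0 < al x y -> A x /\ A y.
Proof.
move=> [z Az zE] xy; set M := al x y in xy.
have M1 := arc_length_itv x y; rewrite -/M in M1.
have alr r : 0 <= r < 1 -> al x (x + pr r) = r by move=> h; exact: arc_lengthP.
have oE r : 0 <= r < 1 -> 0 < r < M -> oarc x y (x + pr r).
  by move=> h h'; rewrite /oarc /= alr.
have sA : oarc x y `<=` ~` A by rewrite zE; exact: connected_component_sub.
have max B : connected B -> B `<=` ~` A -> B (x + pr (M / 2)) -> B `<=` oarc x y.
  move=> cB BA Bm; have : oarc x y (x + pr (M / 2)) by apply: oE; clra.
  rewrite zE => /same_connected_component ->.
  exact: connected_component_max.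
split; apply: contrapT => N.
  have := max _ (@arc_connected x 0 (M / 2)) _ _ x.
  rewrite /oarc /= arc_length0 ltxx /= => H.
  suff : false by []; apply: H.
  - move=> _ [t /= /andP[t0 t1]] <-; rewrite !bnd_simp in t0 t1.
    case: (ltP 0 t) => h; first by apply: sA; apply: oE; clra.
    by have -> : t = 0 by [clra]; rewrite circle_of0 addr0.
  - by exists (M / 2) => //; rewrite /= in_itv /=; clra.
  - by exists 0; rewrite ?circle_of0 ?addr0 //= in_itv /=; clra.
have := max _ (@arc_connected x (M / 2) M) _ _ y.
rewrite /oarc /= ltxx andbF => H.
suff : false by []; apply: H.
- move=> _ [t /= /andP[t0 t1]] <-; rewrite !bnd_simp in t0 t1.
  case: (ltP t M) => h; first by apply: sA; apply: oE; clra.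
  by have -> : t = M by [clra]; rewrite arc_lengthK.
- by exists (M / 2) => //; rewrite /= in_itv /=; clra.
- by exists M; rewrite ?arc_lengthK //= in_itv /=; clra.
Qed.

(** The orbit [A] misses [(a', b)], so it lies in the closed main hole [[b, a']] along with all
    images of the main leaf. *)
Lemma basic_nonrotational_lamination (theta : T) : basic_nonrotational theta ->
  exists E : T -> T -> Prop,
    [/\ invariant_lamination E, ~ degenerate E & E theta (antipode theta)].
Proof.
move=> [_ per [A [k [a [b [[rot Ath Aper comp h2] N N']]]]]].
have M0 : 0 < al (antipode a) b by clra.
have [Aa Ab] := component_endpoints comp M0.
have [k0 per_b _] := Aper _ Ab; have [_ per_a' _] := Aper _ Aa.
have sA : oarc (antipode a) b `<=` ~` A.
  by case: comp => z _ ->; exact: connected_component_sub.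
have orb j x : A x -> A (iter j sg x).
  case: rot => -[x0 _ ->] _ [i _ <-].
  by exists (j + i)%N => //; rewrite iterD.
have hL := arc_length_itv a b.
have LE : al a b = al (antipode a) b - 2^-1.
  have := arc_length_from_antipode a b; case: ltP => h h'; last by clra.
  by have := arc_length_itv (antipode a) b; clra.
have L0 : 0 < al a b by clra.
have L2 : al a b < 2^-1 by have := arc_length_itv (antipode a) b; clra.
have a2 := arc_length_antipode_r a.
have bE := arc_lengthK a b.
have Ahole x : A x -> hole a (al a b) false x.
  move=> Ax; exists (al a x); last by rewrite addr0 arc_lengthK.
  have hx := arc_length_itv a x.
  have nx : ~ oarc (antipode a) b x by move=> /sA.
  have {}nx : ~ [\/ 2^-1 < al a x < al a b, al a x < al a b < 2^-1 | al a b < 2^-1 < al a x].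
    by move=> H; apply: nx; apply/(oarcE a); rewrite a2.
  apply/andP; split; rewrite leNgt; apply/negP => h; apply: nx.
    by constructor 2; clra.
  by constructor 3; clra.
(* [a'] and [b] are at most half a turn counterclockwise from [theta], which forces [theta] into
   [I]. *)
have theta_in : 0 <= al a theta <= al a b.
  have := Ath _ Ab; have := Ath _ Aa; rewrite /carc /= arc_length_antipode_r.
  rewrite !(arc_length_base a theta) a2; have := arc_length_itv a theta.
  by case: (ltP 2^-1 (al a theta)) => ?; case: (ltP (al a b) (al a theta)) => ? /=; clra.
have in_dom x : iter k sg x = x -> hs_domain a b x -> canonic_horseshoe a b k x.
  by move=> xE hx i; have -> : iter (k * i) sg x = x by
    elim: i => [|i IH]; rewrite ?muln0 // mulnS iterD IH.
(* If [theta = a], then [theta' = a'] is fixed by [sigma^k] and stays in [D]. *)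
have na : al a theta != 0.
  apply/eqP => E; apply: N'; have -> : theta = a.
    by apply: (@arc_length_inj _ a); rewrite E arc_length0.
  apply: in_dom => //; right; rewrite /carc /= arc_length0.
  by case/andP: (arc_length_itv (antipode a) (antipode b)).
have nb : al a theta != al a b.
  apply/eqP => /arc_length_inj E; apply: N; rewrite E.
  by apply: in_dom => //; left; rewrite /carc /=.
have esc t : ~ canonic_horseshoe a b k t ->
    exists i, ~ pieces a (al a b) k (iter (k * i) sg t).
  move=> /existsNP[i Ni]; exists i => h; apply: Ni.
  by have := pieces_domain L0 L2 k0 h; rewrite bE.
apply: (@lamination_of_holes a (al a b) k L0 L2 k0 theta); rewrite ?bE //.
- exact: Aper.
- exact: Aper.
- by move=> j _; exists false; split; apply: Ahole; exact: orb.
- left; rewrite /oarc /= !lt_neqAle eq_sym na nb /=; clra.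
- exact: esc.
- exact: esc.
Qed.
End Horseshoe.

Theorem theorem6p4 (R : realType) :
  (forall (a b : circle R) (k : nat) (theta : circle R),
     traveling_horseshoe a b k ->
     is_periodic (sigma theta) ->
     ~ (horseshoe a b k `|` main_holes a b) theta ->
     ~ (horseshoe a b k `|` main_holes a b) (antipode theta) ->
     exists E : circle R -> circle R -> Prop,
       [/\ invariant_lamination E, ~ degenerate E & E theta (antipode theta)])
  /\
  (forall theta : circle R,
     basic_nonrotational theta ->
     exists E : circle R -> circle R -> Prop,
       [/\ invariant_lamination E, ~ degenerate E & E theta (antipode theta)]).
Proof.
split=> [a b k theta|theta]; last exact: basic_nonrotational_lamination.
exact: traveling_horseshoe_lamination.
Qed.
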